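(* Fix $\beta\in(0,1)$. For $n\ge2$ let $r_n=\lfloor n/(\log n)^\beta\rfloor$ and $p_n=(\log n)^{2\beta}/n$, and let $\nu=(\nu_1,\dots,\nu_n)$ be the exchangeable random vector with the following law: with probability $1-p_n$, $\nu_i=1$ for all $i$; with probability $p_n$, choose $i_0$ uniformly from $\{1,\dots,n\}$ and set $\nu_{i_0}=r_n$, choose $r_n-1$ distinct indices $i_1,\dots,i_{r_n-1}$ uniformly from $\{1,\dots,n\}\setminus\{i_0\}$ and set $\nu_{i_1}=\cdots=\nu_{i_{r_n-1}}=0$, and set $\nu_j=1$ for all remaining $j$. Let $q_n$ be the generation-size profile with $q_n(s)=n$ for $1\le s\le n$ and $q_n(s)=0$ for $s\ge n+1$ (so $h(q_n)=n+1$), and let the offspring vectors $\nu^{n,s}$, $1\le s\le n-1$, be i.i.d. copies of $\nu$ (generation $n$ has no offspring). Let $\mathscr T^n$ be the associated Cannings tree and $\widetilde{\mathscr T}^n$ the geometric tree obtained from $\mathscr T^n$ by assigning length $1/n$ to each edge. Then the sequence $(\widetilde{\mathscr T}^n)$ is not tight, i.e. it is not the case that for every $\delta>0$ $$\lim_{k\to\infty}\limsup_{n\to\infty}\mathbb P_n\big(\Delta(n,k)>\delta n\big)=0 .$$ Consequently, with $\ell=\sigma=\mathbf 1_{[0,1)}$, the convergence in distribution $$\Big(n^{-1}C_{\lfloor 2n^2t_1\rfloor}(\mathscr T^n),\,n^{-1}H_{\lfloor n^2t_2\rfloor}(\mathscr T^n)\Big)_{t_1,t_2\ge0}\longrightarrow\Big(W^{\ell^\sigma}_{\alpha^{-1}(t_1)},\,W^{\ell^\sigma}_{\alpha^{-1}(t_2)}\Big)_{t_1,t_2\ge0}$$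 in $\big(D[0,\infty)\big)^2$ with the product Skorokhod topology (functions extended by $0$ outside their domains) fails, where $\ell^\sigma=4\ell/\sigma^2$ on $[0,1)$ and $0$ elsewhere, i.e. $\ell^\sigma=4\cdot\mathbf 1_{[0,1)}$, and $\alpha(t)=\frac14\int_0^t\sigma(W^{\ell^\sigma}_s)^2\,ds$.
   Context: **Cannings tree.** Given generation sizes $q_n(s)$ and independent exchangeable offspring vectors $\nu^{n,s}=(\nu^{n,s}_1,\dots,\nu^{n,s}_{q_n(s)})$ with $\sum_i\nu^{n,s}_i=q_n(s+1)$, $\mathscr T^n$ is the random rooted ordered tree whose root (height $0$) has $q_n(1)$ children, and in which, for $s\ge1$, the $q_n(s)$ vertices at height $s$, in lexicographic (left-to-right) order, have $\nu^{n,s}_1,\dots,\nu^{n,s}_{q_n(s)}$ children respectively (children of an earlier vertex precede those of a later one). $V(\cdot)$ denotes vertex set and $d$ the graph distance. $\mathbb P_n$ is the probability under the $n$-th model. $\Delta(n,k):=\max_{v\in V(\mathscr T^n)}\min_{u\in V(\mathscr T^n_k)}d(v,u)$, where $\mathscr T^n_k$ is the subtree of $\mathscr T^n$ spanned by the root and $V^n_1,\dots,V^n_k$, with $(V^n_1,\dots,V^n_{\#V(\mathscr T^n)})$ a uniform random ordering of $V(\mathscr T^n)$ ($1\le k\le\#V(\mathscr T^n)$). **Height and contour functions.** If $v_0\prec v_1\prec\cdots$ are all vertices in lexicographic order, $H_i(\mathscr T^n)$ is the height (graph distance to the root) of $v_i$, $0\le i<\#V(\mathscr T^n)$. $C_i(\mathscr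 T^n)$, $0\le i\le2(\#V(\mathscr T^n)-1)$, is the height after $i$ steps of a particle that starts at the root and performs the depth-first left-to-right traversal crossing each edge exactly twice, one edge per unit time. **Conditioned Brownian motion.** $C_{\rm bridge}=\{g\in C[0,1]:g(0)=g(1)=0,\ g\ge0\}$. For $g\in C_{\rm bridge}$, $d_g(s,t)=g(s)+g(t)-2\min_{[s\wedge t,s\vee t]}g$; $\mathcal T_g=[0,1]/\{d_g=0\}$ is a compact real tree with projection $p_g$, rooted at $p_g(0)$, ordered by $x\prec y$ iff $\min p_g^{-1}(x)<\min p_g^{-1}(y)$; its uniform $k$-point subtree is the union of geodesics from the root to $p_g(U_1),\dots,p_g(U_k)$, $U_i$ i.i.d. uniform on $[0,1]$ independent of $g$. Let $\ell:\mathbb R_+\to\mathbb R_+$ vanish on $[h,\infty)$ and be continuous and positive on $(0,h)$, continuous at $0$, with a finite left limit at $h<\infty$; $I(\ell)=\int_0^\infty\ell$. $W^\ell$ is (the canonical version of) reflected Brownian motion run until its local time at $0$ exceeds $\ell(0)$, conditioned on its local time profile being $\ell$: if $I(\ell)=1$, $W^\ell$ is the random element of $C_{\rm bridge}$ whose law is characterized by the fact that for each $k$ its uniform $k$-point subtree has the law of the tree built from $k$ particles born at independent heights with density $\ell(x)\,dx$; as the height $t$ decreases to $0$ each pair of existing clusters merges at rate $4/\ell(t)$; at height $0$ all remaining clusters merge (the root); birth heights are leaf heights, mergers are branch points, left-right orders are uniformly random and independent. In general, with $\tilde\ell(s)=I(\ell)^{-1/2}\ell(I(\ell)^{1/2}s)$,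 $W^\ell_t:=I(\ell)^{1/2}W^{\tilde\ell}_{t/I(\ell)}$, $0\le t\le I(\ell)$. *)

(* Defs.v *)
From HB Require Import structures.
From mathcomp Require Import all_boot all_order all_algebra all_fingroup.
From mathcomp Require Import all_classical all_reals all_analysis.
Set Implicit Arguments.
Unset Strict Implicit.
Unset Printing Implicit Defensive.
Import Order.TTheory GRing.Theory Num.Theory.
Import numFieldNormedType.Exports.
Local Open Scope classical_set_scope.
Local Open Scope ring_scope.

Inductive otree := Node of seq otree.

(* Vertices in Ulam-Harris notation, listed in lexicographic order. *)
Fixpoint vertices (t : otree) : seq (seq nat) :=
  let: Node l := t in
  [::] :: flatten [seq map (cons p.1) p.2
                  | p <- zip (iota 0 (size l)) (map vertices l)].

Fixpoint contour_from (d : nat) (t : otree) : seq nat :=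
  let: Node l := t in
  d :: flatten (map (fun c => rcons (contour_from d.+1 c) d) l).

Definition contour : otree -> seq nat := contour_from 0.

(* The height of a vertex is the length of its address.  Reading past the end
   of either list gives 0: both functions are extended by 0. *)
Definition H_ (t : otree) (i : nat) : nat := nth 0%N (map size (vertices t)) i.
Definition C_ (t : otree) (i : nat) : nat := nth 0%N (contour t) i.

Definition vertex (t : otree) : finType := seq_sub (vertices t).

Definition is_child {t : otree} (u v : vertex t) : bool :=
  (size (val v) == (size (val u)).+1) && prefix (val u) (val v).

Definition adjacent {t : otree} : rel (vertex t) :=
  [rel u v | is_child u v || is_child v u].

Definition gdist {t : otree} (u v : vertex t) : nat :=
  find (fun m => [exists p : m.-tuple (vertex t),
                    path adjacent u p && (last u p == v)])
       (iota 0 #|vertex t|).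

(* [V_ pi j] is the (j+1)-st vertex of the ordering of the vertices given by
   [pi], which is uniform when [pi] is. *)
Definition V_ {t : otree} (pi : {perm 'I_#|vertex t|}) (j : 'I_#|vertex t|)
  : vertex t := enum_val (pi j).

(* The union of the paths from the root to the first k vertices: the vertices
   on the path from the root to v are the prefixes of v. *)
Definition spanned {t : otree} (pi : {perm 'I_#|vertex t|}) (k : nat)
    (u : vertex t) : bool :=
  (val u == [::]) ||
  [exists j : 'I_#|vertex t|, (j < k)%N && prefix (val u) (val (V_ pi j))].

(* Distances are < #|vertex t| and the root is always spanned, so the default
   value of the minimum is never reached. *)
Definition Delta {t : otree} (pi : {perm 'I_#|vertex t|}) (k : nat) : nat :=
  \max_(v : vertex t)
     \big[minn/#|vertex t|]_(u : vertex t | spanned pi k u) gdist v u.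

(* Generations are numbered from 1; h is the first empty one.  The individuals
   of a generation are numbered from 0. *)
Definition cannings_tree (h : nat) (q : nat -> nat) (nu : nat -> nat -> nat)
  : otree :=
  Node (foldr (fun s next => map Node (reshape (mkseq (nu s) (q s)) next))
              [::] (iota 1 h.-1)).

Section model.
Context {R : realType} (beta : R).

Definition r_ (n : nat) : nat := Num.truncn (n%:R / ln n%:R `^ beta : R).
Definition p_ (n : nat) : R := ln n%:R `^ (2 * beta) / n%:R.
Definition q_ (n s : nat) : nat := if (1 <= s <= n)%N then n else 0%N.

(* [None]: everybody has one child.  [Some (i0, A)]: i0 has [r_ n] children,
   the individuals in A have none. *)
Definition draw (n : nat) : finType := option ('I_n * {set 'I_n}).

Definition draw_pmf (n : nat) (o : draw n) : R :=
  match o with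
  | None => 1 - p_ n
  | Some (i0, A) =>
      if (i0 \notin A) && (#|A| == (r_ n).-1)
      then p_ n / n%:R / 'C(n.-1, (r_ n).-1)%:R else 0
  end.

Definition nu_of (n : nat) (o : draw n) (i : 'I_n) : nat :=
  match o with
  | None => 1%N
  | Some (i0, A) => if i == i0 then r_ n else if i \in A then 0%N else 1%N
  end.

(* The draw with index j gives the offspring of generation j+1. *)
Definition draws (n : nat) : finType := {ffun 'I_n.-1 -> draw n}.

Definition draws_pmf (n : nat) (w : draws n) : R := \prod_j draw_pmf (w j).

Definition offspring (n : nat) (w : draws n) (s i : nat) : nat :=
  match insub s.-1 : option 'I_n.-1, insub i : option 'I_n with
  | Some j, Some i' => nu_of (w j) i'
  | _, _ => 0%N
  end.

Definition tree_ (n : nat) (w : draws n) : otree :=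
  cannings_tree n.+1 (q_ n) (offspring w).

Definition E_ (n : nat) (X : draws n -> R) : R := \sum_w draws_pmf w * X w.

(* Given the tree, the ordering of its vertices is uniform. *)
Definition Pr_Delta_gt (n k : nat) (x : R) : R :=
  E_ (fun w : draws n =>
    #|[pred pi : {perm 'I_#|vertex (tree_ w)|} | x < (Delta pi k)%:R]|%:R
    / #|{: {perm 'I_#|vertex (tree_ w)|}}|%:R).

Definition tree_tight : Prop := forall delta : R, 0 < delta ->
  limn_esup (fun n => (Pr_Delta_gt n k (delta * n%:R))%:E)
    @[k --> \oo] --> 0%E.

End model.

Section skorokhod.
Context {R : realType}.

Definition cadlag (f : R -> R) : Prop :=
  (forall t, 0 <= t -> f s @[s --> t^'+] --> f t) /\
  (forall t, 0 < t -> cvg (f s @[s --> t^'-])).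

(* A function on [0, oo) is represented by its extension by 0 to R. *)
Record skorokhod := Skorokhod {
  skfun :> R -> R;
  skfun_cadlag : cadlag skfun;
  skfun_neg : forall t, t < 0 -> skfun t = 0 }.

(* An increasing bijection of [0, oo), hence continuous. *)
Definition time_change (la : R -> R) : Prop :=
  [/\ la 0 = 0, (forall s t, 0 <= s -> s < t -> la s < la t) &
      (forall y, 0 <= y -> exists2 x, 0 <= x & la x = y)].

(* sup_t |la t - t| < e and sup_(t <= N) |y (la t) - x t| < e *)
Definition sk_ball (x : skorokhod) (N e : R) : set skorokhod :=
  [set y | exists la e', [/\ time_change la, e' < e,
     (forall t, 0 <= t -> `|la t - t| <= e') &
     (forall t, 0 <= t <= N -> `|y (la t) - x t| <= e')]].

(* The J1 topology: x_n --> x iff there are time changes la_n such that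
   la_n - id --> 0 uniformly on [0, oo) and x_n \o la_n --> x uniformly on
   [0, N] for all N. *)
Definition sk_nbhs (x : skorokhod) : set_system skorokhod :=
  [set A | exists N e, [/\ 0 < N, 0 < e & sk_ball x N e `<=` A]].

Lemma time_change_id : time_change id.
Proof. by split=> // y y0; exists y. Qed.

Lemma time_change_ge0 la t : time_change la -> 0 <= t -> 0 <= la t.
Proof.
move=> [l0 li _]; rewrite le_eqVlt => /predU1P[<-|t0]; first by rewrite l0.
by rewrite -l0; apply/ltW/li.
Qed.

Lemma time_change_comp la mu :
  time_change la -> time_change mu -> time_change (mu \o la).
Proof.
move=> Tl Tm; have [l0 li ls] := Tl; have [m0 mi ms] := Tm; split.
- by rewrite /= l0.
- move=> s t s0 st /=; apply: mi; last exact: li.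
  exact: time_change_ge0.
- move=> y /ms[x x0 <-]; have [z z0 <-] := ls _ x0.
  by exists z.
Qed.

Lemma sk_ball_center x N e : 0 < e -> sk_ball x N e x.
Proof.
move=> e0; exists id, 0; split=> //; first exact: time_change_id.
- by move=> t _; rewrite subrr normr0.
- by move=> t _; rewrite subrr normr0.
Qed.

Lemma sk_ball_le x N N' e e' : N' <= N -> e <= e' ->
  sk_ball x N e `<=` sk_ball x N' e'.
Proof.
move=> NN ee y [la [d [Tl de l1 l2]]]; exists la, d; split=> //.
  exact: lt_le_trans ee.
by move=> t /andP[t0 tN]; apply: l2; rewrite t0 (le_trans tN).
Qed.

Lemma sk_nbhs_filter x : ProperFilter (sk_nbhs x).
Proof.
apply: Build_ProperFilter_ex.
  by move=> A [N [e [N0 e0 NA]]]; exists x; apply/NA/sk_ball_center.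
split.
- by exists 1, 1; split.
- move=> A B [N [e [N0 e0 NA]]] [M [d [M0 d0 MB]]].
  exists (Num.max N M), (Num.min e d); split.
  + by rewrite lt_max N0.
  + by rewrite lt_min e0.
  + move=> y yb; split.
    * by apply/NA; apply: sk_ball_le yb; rewrite ?le_max ?ge_min lexx.
    * by apply/MB; apply: sk_ball_le yb; rewrite ?le_max ?ge_min lexx orbT.
- move=> A B AB [N [e [N0 e0 NA]]]; exists N, e; split=> //.
  exact: subset_trans AB.
Qed.

Lemma sk_nbhs_singleton x A : sk_nbhs x A -> A x.
Proof. by move=> [N [e [N0 e0]]]; apply; exact: sk_ball_center. Qed.

Lemma sk_nbhs_nbhs x A : sk_nbhs x A -> sk_nbhs x (sk_nbhs^~ A).
Proof.
move=> [N [e [N0 e0 NA]]]; exists N, e; split=> // y [la [d [Tl de l1 l2]]].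
have d0 : 0 <= d by apply: le_trans (l1 0 (lexx _)).
exists (N + d), (e - d); split.
- by rewrite ltr_wpDr.
- by rewrite subr_gt0.
- move=> z [mu [c [Tm ce m1 m2]]]; apply: NA.
  exists (mu \o la), (c + d); split.
  + exact: time_change_comp.
  + by rewrite -ltrBrDr.
  + move=> t t0 /=.
    rewrite -(subrKA (la t)) (le_trans (ler_normD _ _))// lerD//; last exact: l1.
    exact/m1/time_change_ge0.
  + move=> t /andP[t0 tN] /=.
    rewrite -(subrKA (y (la t))) (le_trans (ler_normD _ _))// lerD//.
      apply: m2; rewrite time_change_ge0//= -lerBlDl.
      rewrite (le_trans _ (le_trans (ler_norm _) (l1 _ t0)))//.
      exact: lerB.
    by apply: l2; rewrite t0.
Qed.

HB.instance Definition _ := gen_eqMixin skorokhod.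
HB.instance Definition _ := gen_choiceMixin skorokhod.
HB.instance Definition _ := hasNbhs.Build skorokhod sk_nbhs.
HB.instance Definition _ := Nbhs_isNbhsTopological.Build skorokhod
  sk_nbhs_filter sk_nbhs_singleton sk_nbhs_nbhs.

End skorokhod.
Arguments skorokhod R : clear implicits.

Section paths.
Context {R : realType}.

Definition on_halfline (f : R -> R) (t : R) : R := if t < 0 then 0 else f t.

Lemma on_halfline_neg f t : t < 0 -> on_halfline f t = 0.
Proof. by rewrite /on_halfline => ->. Qed.

Lemma cadlag_on_halfline f : cadlag f -> cadlag (on_halfline f).
Proof.
move=> [fr fl]; split=> t t0.
- rewrite {2}/on_halfline ltNge t0/=; apply: cvg_trans (fr _ t0).
  apply: near_eq_cvg; near=> s.
  have ts : t <= s by near: s; exact: nbhs_right_ge.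
  by rewrite /on_halfline ltNge (le_trans t0).
- have /cvg_ex[l fl'] := fl _ t0; apply/cvg_ex; exists l.
  apply: cvg_trans fl'; apply: near_eq_cvg; near=> s.
  have s0 : 0 < s by near: s; exact: nbhs_left_gt.
  by rewrite /on_halfline ltNge ltW.
Unshelve. all: by end_near. Qed.

Definition step (u : nat -> R) (c : R) (t : R) : R := u (Num.truncn (c * t)).

Lemma cadlag_step u c : 0 <= c -> cadlag (step u c).
Proof.
rewrite le_eqVlt => /predU1P[<-|c0].
  have -> : step u 0 = cst (u 0%N).
    by apply/funext => t; rewrite /step mul0r truncn0.
  split=> t _; first exact: cvg_cst.
  exact: is_cvg_cst.
split=> t t0.
- have ct0 : 0 <= c * t by rewrite mulr_ge0// ltW.
  have /andP[ml mr] := truncn_itv ct0.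
  apply: cvg_near_cst; near=> s.
  have ts : t <= s by near: s; exact: nbhs_right_ge.
  have sm : s < (Num.truncn (c * t)).+1%:R / c.
    by near: s; apply: nbhs_right_lt; rewrite ltr_pdivlMr// mulrC.
  rewrite /step; congr u; apply: truncn_def; apply/andP; split.
    by rewrite (le_trans ml)// ler_pM2l.
  by move: sm; rewrite ltr_pdivlMr// mulrC.
- have ct0 : 0 < c * t by rewrite mulr_gt0.
  have [m [ml mr]] : exists m : nat, m%:R < c * t /\ c * t <= m.+1%:R.
    have /andP[] := truncn_itv (ltW ct0); set m := Num.truncn _ => ml mr.
    move: ml; rewrite le_eqVlt => /predU1P[mE|ml].
      case: m mE {mr} => [|m] mE; first by rewrite -mE ltxx in ct0.
      by exists m; rewrite -mE lexx ltr_nat ltnSn.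
    by exists m; rewrite ltW.
  apply/cvg_ex; exists (u m); apply: cvg_near_cst; near=> s.
  have st : s < t by near: s; exact: nbhs_left_lt.
  have ms : m%:R / c < s.
    by near: s; apply: nbhs_left_gt; rewrite ltr_pdivrMr// mulrC.
  rewrite /step; congr u; apply: truncn_def; apply/andP; split.
    by move: ms; rewrite ltr_pdivrMr// mulrC => /ltW.
  by apply: lt_le_trans mr; rewrite ltr_pM2l.
Unshelve. all: by end_near. Qed.

(* The right-continuous inverse of the increasing function a on [0, I], equal
   to I beyond the range of a. *)
Definition right_inverse (a : R -> R) (I : R) (t : R) : R :=
  inf ([set s | 0 <= s <= I /\ t < a s] `|` [set I]).

Lemma right_inverse_le a I s t : s <= t ->
  right_inverse a I s <= right_inverse a I t.
Proof.
move=> st; apply: lb_le_inf; first by exists I; right.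
move=> x xt; apply: ge_inf.
  by exists (Num.min 0 I) => y [[/andP[y0 _] _]| ->]; rewrite ge_min ?y0 ?lexx ?orbT.
by case: xt => [[xI tx]|->]; [left; split=> //; exact: le_lt_trans tx|right].
Qed.

Lemma right_inverse_leI a I t : right_inverse a I t <= I.
Proof.
apply: ge_inf; last by right.
by exists (Num.min 0 I) => y [[/andP[y0 _] _]| ->]; rewrite ge_min ?y0 ?lexx ?orbT.
Qed.

Lemma right_inverse_cvg a I t :
  right_inverse a I s @[s --> t^'+] --> right_inverse a I t.
Proof.
apply/cvgrPdist_lt => e e0.
have hinf : has_inf ([set s | 0 <= s <= I /\ t < a s] `|` [set I]).
  split; first by exists I; right.
  by exists (Num.min 0 I) => y [[/andP[y0 _] _]| ->]; rewrite ge_min ?y0 ?lexx ?orbT.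
have [x xt xe] := inf_adherent e0 hinf.
have key : \forall s \near t^'+, right_inverse a I s <= x.
  case: xt => [[xI tx]|->]; last by apply: nearW => s; exact: right_inverse_leI.
  near=> s; apply: ge_inf; first by
    exists (Num.min 0 I) => y [[/andP[y0 _] _]| ->]; rewrite ge_min ?y0 ?lexx ?orbT.
  by left; split=> //; near: s; exact: nbhs_right_lt.
near=> s.
have ts : t <= s by near: s; exact: nbhs_right_ge.
have sx : right_inverse a I s <= x by near: s.
rewrite distrC ger0_norm ?subr_ge0 ?right_inverse_le//.
by rewrite ltrBlDl (le_lt_trans sx).
Unshelve. all: by end_near. Qed.

Lemma cadlag_comp_right_inverse w a I : continuous w ->
  cadlag (w \o right_inverse a I).
Proof.
move=> cw; split=> t _.
  by apply: (@continuous_cvg _ _ _ _ _ _ w); [exact: (cw _)|exact: right_inverse_cvg].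
have /cvg_ex[l bl] : cvg (right_inverse a I s @[s --> t^'-]).
  apply: nondecreasing_at_left_is_cvgr.
    by apply: nearW => x y z _ _; exact: right_inverse_le.
  by apply: nearW => x; exists I => _ [y _ <-]; exact: right_inverse_leI.
by apply/cvg_ex; exists (w l); apply: (@continuous_cvg _ _ _ _ _ _ w) => //; exact: (cw l).
Qed.

Definition sk_step u c (c0 : 0 <= c) : skorokhod R :=
  Skorokhod (cadlag_on_halfline (cadlag_step u c0))
            (@on_halfline_neg (step u c)).

Definition sk_time_changed w (cw : continuous w) a I : skorokhod R :=
  Skorokhod (cadlag_on_halfline (cadlag_comp_right_inverse a I cw))
            (@on_halfline_neg (w \o right_inverse a I)).

End paths.

(* C_bridge, each function on [0, 1] being extended by 0 to R. *)
Record Cbridge (R : realType) := MkCbridge {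
  bridge :> R -> R;
  bridge_continuous : continuous bridge;
  bridge_ge0 : forall t, 0 <= bridge t;
  bridge_out : forall t, ~ (0 < t < 1) -> bridge t = 0 }.

Section ltree.
Context {R : realType}.

(* A rooted ordered real tree spanned by its root and k labelled points, given
   up to isomorphism by the distances from the root to the points, the
   distances between the points, and the order of the points. *)
Record ltree (k : nat) := Ltree {
  ht : 'I_k -> R;
  dist : 'I_k -> 'I_k -> R;
  prec : 'I_k -> 'I_k -> Prop }.

Definition ltree_measurable (k : nat) : set (set (ltree k)) :=
  <<s [set A | (exists i x, A = [set T | ht T i <= x]) \/
               (exists i j x, A = [set T | dist T i j <= x]) \/
               (exists i j, A = [set T | prec T i j])] >>.

Local Notation mu := (@lebesgue_measure R).

Fixpoint E_iid_seq (f : R -> R) (m : nat) (F : seq R -> \bar R) : \bar R :=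
  match m with
  | 0 => F [::]
  | m'.+1 => \int[mu]_x ((f x)%:E * E_iid_seq f m' (fun s => F (x :: s)))
  end%E.

(* The expectation of F X, where the X i are independent with density f. *)
Definition E_iid (f : R -> R) (I : finType) (F : (I -> R) -> \bar R) : \bar R :=
  E_iid_seq f #|I| (fun s => F (fun i => nth 0 s (enum_rank i))).

Section reduced_tree.
Variable g : Cbridge R.

Definition d_ (s t : R) : R :=
  g s + g t - 2 * inf (g @` `[Num.min s t, Num.max s t]).

(* The least s in the class of t, for the order of the tree. *)
Definition first_visit (t : R) : R :=
  inf [set s | 0 <= s <= 1 /\ d_ s t = 0].

Definition reduced_tree (k : nat) (U : 'I_k -> R) : ltree k :=
  Ltree (fun i => d_ 0 (U i)) (fun i j => d_ (U i) (U j))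
        (fun i j => first_visit (U i) < first_visit (U j)).

End reduced_tree.

Section coalescent.
Variables (ell : R -> R) (k : nat).

Let cluster : finType := {set 'I_k}.

Record coal_state := CoalState {
  clusters : {set cluster};
  since : cluster -> R;               (* height at which a cluster appears *)
  mheight : 'I_k -> 'I_k -> R;        (* height of the last common ancestor *)
  left_of : 'I_k -> 'I_k -> bool }.

(* The first height, going down from c, at which a clock of rate
   4 / ell t at height t rings, e being standard exponential; 0 if there is
   none. *)
Definition ring_height (c e : R) : R :=
  sup [set t | t = 0 \/
    (0 <= t <= c /\ (e%:E <= \int[mu]_(x in `[t, c]) (4 / ell x)%:E)%E)].

(* b i is the birth height of particle i; each pair of clusters has its own
   exponential variable e [set A; B]; coin C decides the left-right order of
   the two clusters which merge into C; the permutation s orders the clusters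
   at the root. *)
Variables (b : 'I_k -> R) (e : {set cluster} -> R)
  (coin : {ffun cluster -> bool}) (s : {perm cluster}).

Definition coal_init : coal_state := CoalState
  [set [set i]%SET | i : 'I_k]%SET
  (fun A => if [pick i in A] is Some i then b i else 0)
  (fun i j => if i == j then b i else 0)
  (fun i j => false).

Definition coal_step (S : coal_state) : coal_state :=
  let ring (AB : cluster * cluster) :=
    ring_height (Num.min (since S AB.1) (since S AB.2)) (e [set AB.1; AB.2]%SET)
  in
  let candidate (AB : cluster * cluster) :=
    [&& AB.1 \in clusters S, AB.2 \in clusters S & AB.1 != AB.2] in
  if [pick AB | [&& candidate AB, 0 < ring AB &
        [forall CD, candidate CD ==> (ring CD <= ring AB)]]] is Some AB
  then
    let: (A, B) := AB in
    CoalState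
      ((A :|: B) |: (clusters S :\ A :\ B))%SET
      (fun C => if C == (A :|: B)%SET then ring AB else since S C)
      (fun i j => if (i \in A) && (j \in B) || (i \in B) && (j \in A)
                  then ring AB else mheight S i j)
      (fun i j => if (i \in A) && (j \in B) then coin (A :|: B)%SET
                  else if (i \in B) && (j \in A) then ~~ coin (A :|: B)%SET
                  else left_of S i j)
  else S.

(* There are at most k - 1 mergers above height 0. *)
Definition coal_final : coal_state := iter k coal_step coal_init.

Definition coal_left_of (i j : 'I_k) : bool :=
  let A := finset.pblock (clusters coal_final) i in
  let B := finset.pblock (clusters coal_final) j in
  if A == B then left_of coal_final i j
  else (enum_rank (s A) < enum_rank (s B))%N.

Definition coal_tree : ltree k :=
  Ltree b (fun i j => b i + b j - 2 * mheight coal_final i j) coal_left_of.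

End coalescent.

Definition coal_prob (ell : R -> R) (k : nat) (A : set (ltree k)) : \bar R :=
  E_iid ell (fun b : 'I_k -> R =>
    E_iid (exponential_pdf 1) (fun e : {set {set 'I_k}} -> R =>
      ((\sum_(coin : {ffun {set 'I_k} -> bool}) \sum_(s : {perm {set 'I_k}})
          \1_A (coal_tree ell b e coin s))
       / (#|{: {ffun {set 'I_k} -> bool}}| * #|{: {perm {set 'I_k}}}|)%:R)%:E)).

Definition reduced_prob d (Omega : measurableType d) (P : probability Omega R)
    (W : Omega -> Cbridge R) (k : nat) (A : set (ltree k)) : \bar R :=
  (\int[P]_w E_iid (uniform_pdf 0 1)
     (fun U : 'I_k -> R => (\1_A (reduced_tree (W w) U))%:E))%E.

(* W is a version of W^ell, where I(ell) = 1. *)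
Definition conditioned_BM1 (ell : R -> R) d (Omega : measurableType d)
    (P : probability Omega R) (W : Omega -> Cbridge R) : Prop :=
  (forall t, measurable_fun [set: Omega] (fun w => W w t)) /\
  (forall k (A : set (ltree k)), ltree_measurable A ->
     reduced_prob P W A = coal_prob ell A).

End ltree.

Section general_profile.
Context {R : realType}.
Local Notation mu := (@lebesgue_measure R).

Definition I_ (ell : R -> R) : R := (\int[mu]_(x in `[0, +oo[) ell x)%R.

Definition normalized (ell : R -> R) (s : R) : R :=
  ell (Num.sqrt (I_ ell) * s) / Num.sqrt (I_ ell).

(* If W1 is a version of W^(normalized ell), then [rescaled ell (W1 w)] is the
   path of W^ell, extended by 0 outside [0, I_ ell]. *)
Definition rescaled (ell : R -> R) (g : Cbridge R) (t : R) : R :=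
  Num.sqrt (I_ ell) * g (t / I_ ell).

Lemma rescaled_continuous ell g : continuous (rescaled ell g).
Proof.
move=> t; apply: cvgMl_tmp; apply: (@continuous_cvg _ _ _ _ _ (fun s => s / I_ ell) g).
  exact: (@bridge_continuous _ g (t / I_ ell)).
by apply: cvgMr_tmp; exact: cvg_id.
Qed.

Definition ell_sigma (h : R) (ell sigma : R -> R) (s : R) : R :=
  if 0 <= s < h then 4 * ell s / sigma s ^+ 2 else 0.

Definition alpha (sigma w : R -> R) (t : R) : R :=
  4^-1 * (\int[mu]_(s in `[0, t]) (sigma (w s) ^+ 2))%R.

(* t |-> W^l_(alpha^-1 t).  As W^l vanishes at I_ l, the value is 0 beyond the
   range of alpha. *)
Definition limit_path (l sigma : R -> R) (g : Cbridge R) : skorokhod R :=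
  sk_time_changed (@rescaled_continuous l g)
    (alpha sigma (rescaled l g)) (I_ l).

End general_profile.

Section scaling.
Context {R : realType} (beta : R).

Lemma scale_ge0 (a n : nat) : 0 <= a%:R * n%:R ^+ 2 :> R.
Proof. by rewrite mulr_ge0// exprn_ge0. Qed.

Definition scaled_contour (n : nat) (w : draws n) : skorokhod R :=
  sk_step (fun i => (C_ (tree_ beta w) i)%:R / n%:R) (scale_ge0 2 n).

Definition scaled_height (n : nat) (w : draws n) : skorokhod R :=
  sk_step (fun i => (H_ (tree_ beta w) i)%:R / n%:R) (scale_ge0 1 n).

(* Convergence in distribution, in the product topology of D[0, oo)^2, of the
   pairs X_n under the n-th model to Y. *)
Definition cvg_in_law (X : forall n, draws n -> skorokhod R * skorokhod R)
    d (Omega : measurableType d) (P : probability Omega R)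
    (Y : Omega -> skorokhod R * skorokhod R) : Prop :=
  forall F : skorokhod R * skorokhod R -> R,
    continuous F -> (exists M, forall x, `|F x| <= M) ->
    (E_ beta (fun w => F (X n w)))%:E @[n --> \oo] --> 'E_P[F \o Y]%E.

End scaling.

(* Main.v *)
Require Import Defs.
From mathcomp Require Import all_boot all_order all_algebra all_fingroup.
From mathcomp Require Import all_classical all_reals all_analysis.
From mathcomp Require Import measurable_realfun zify ring lra.
Set Implicit Arguments.
Unset Strict Implicit.
Unset Printing Implicit Defensive.
Import Order.TTheory GRing.Theory Num.Theory.
Import numFieldNormedType.Exports.
Import HBNNSimple.

(* Let K be the number of vertices at height n/2 with a descendant at height n.
   Follow forward in time the families founded at height n/2: an event kills a
   uniform set of r_n - 1 individuals, so keeping one representative per family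
   shows that it multiplies E[1 / (1 + K)] by at most (n + 1) / (n + 2 - r_n).
   With at most n generations, each with an event with probability p_n, and
   L = log n, this gives E[1 / (1 + K)] <= exp (2 L^beta - L) --> 0: K tends to
   infinity in probability.

   When K > k, one of these K vertices has no sampled descendant, and its
   descendants at height n are at distance more than n/2 from the subtree
   spanned by the sample: there is no tightness.  The height function makes K
   upward moves from n/2 to n.  The size of the smallest move among the best m
   successive upward moves of a path is a continuous functional for the J1
   topology, which stays away from 0 in mean along the trees but tends to 0 as
   m grows for every cadlag path: whatever the law of the limit, there is no
   convergence. *)

(** * Trees *)

(** The induction principle generated for [otree] says nothing about the trees inside the list;
    [foldr] supplies a hypothesis for each of them, in a shape that an inner induction on the list
    can split. *)
Lemma otree_nested_ind (P : otree -> Prop) :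
    (forall l, foldr (fun t acc => P t /\ acc) True l -> P (Node l)) ->
  forall t, P t.
Proof.
move=> IH; fix otree_nested_ind 1 => -[l]; apply: IH.
by elim: l => [|t l IHl]; split.
Qed.

(* The vertices other than the root, when the first child has index k. *)
Definition forest_vertices (k : nat) (l : seq otree) : seq (seq nat) :=
  flatten [seq map (cons p.1) p.2
          | p <- zip (iota k (size l)) (map vertices l)].

Lemma forest_vertices_cons k t l :
  forest_vertices k (t :: l) =
  map (cons k) (vertices t) ++ forest_vertices k.+1 l.
Proof. by []. Qed.

Lemma vertices_Node l : vertices (Node l) = [::] :: forest_vertices 0 l.
Proof. by []. Qed.

Lemma forest_vertices_head k l v :
  v \in forest_vertices k l -> exists i w, v = i :: w /\ (k <= i)%N.
Proof.
elim: l k => [//|t l IH] k; rewrite forest_vertices_cons mem_cat => /orP[].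
  by case/mapP=> w _ ->; exists k, w.
by case/IH=> i [w [-> /ltnW ki]]; exists i, w.
Qed.

Lemma vertices_uniq t : uniq (vertices t).
Proof.
elim/otree_nested_ind: t => l H; rewrite vertices_Node cons_uniq.
apply/andP; split.
  by apply/negP => /forest_vertices_head[i [w []]].
elim: l H (0%N) => [//|t l IH] [ut ul] k.
rewrite forest_vertices_cons cat_uniq IH // andbT map_inj_uniq ?ut => [/=|x y []//].
apply/hasPn => v /forest_vertices_head[i [w [-> ki]]].
by apply/negP => /mapP[x _ [E _]]; rewrite E ltnn in ki.
Qed.

Lemma size_forest_vertices k l :
  size (forest_vertices k l) = sumn (map (size \o vertices) l).
Proof.
elim: l k => [//|t l IH] k.
by rewrite forest_vertices_cons size_cat size_map IH.
Qed.

Fixpoint reaches (d : nat) (t : otree) : bool :=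
  if d is d'.+1 then let: Node l := t in has (reaches d') l else true.

(* The number of vertices at height s with a descendant at height s + d. *)
Fixpoint survivors (s d : nat) (t : otree) : nat :=
  if s is s'.+1 then let: Node l := t in sumn (map (survivors s' d) l)
  else reaches d t.

Lemma reachesP d t : reaches d t -> exists2 v, v \in vertices t & size v = d.
Proof.
elim: d t => [|d IH] [l] /=; first by move=> _; exists [::].
move=> H; suff [v vl <-] : exists2 v, v \in forest_vertices 0 l & size v = d.+1.
  by exists v => //; rewrite inE vl orbT.
elim: l H (0%N) => [//|t l IHl] /= H k; rewrite forest_vertices_cons.
case/orP: H => [/IH[v vt <-]|/IHl/(_ k.+1)[v vl <-]].
  by exists (k :: v) => //; rewrite mem_cat map_f.
by exists v => //; rewrite mem_cat vl orbT.
Qed.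

(** Listing the members of each pair in turn lets one [subseq] record that the pairs follow each
    other without interleaving. *)
Definition pair_flatten {T : Type} (Z : seq (T * T)) : seq T :=
  flatten [seq [:: z.1; z.2] | z <- Z].

Lemma pair_flatten_cat (T : Type) (Z1 Z2 : seq (T * T)) :
  pair_flatten (Z1 ++ Z2) = pair_flatten Z1 ++ pair_flatten Z2.
Proof. by rewrite /pair_flatten map_cat flatten_cat. Qed.

(** Each surviving vertex is paired with one descendant. Pairs do not interleave because the
    subtrees of siblings occupy successive segments of the lexicographic order; [0 < d] keeps the
    two members of a pair distinct. *)
Lemma survivors_subseq s d t : (0 < d)%N ->
  exists Z : seq (seq nat * seq nat),
  [/\ size Z = survivors s d t,
      all (fun z => [&& size z.1 == s, size z.2 == s + d & prefix z.1 z.2]) Z &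
      subseq (pair_flatten Z) (vertices t)].
Proof.
move=> d0; elim: s t => [|s IH] t.
  rewrite /survivors; case E: (reaches d t); last by exists [::]; rewrite sub0seq.
  have [v vt vd] := reachesP E; exists [:: ([::], v)]; split=> //=.
    by rewrite vd eqxx prefix0s.
  case: t E vt => l _; rewrite vertices_Node /= inE => /orP[/eqP v0|].
    by rewrite v0 /= in vd; rewrite -vd in d0.
  by rewrite sub1seq.
case: t => l; rewrite vertices_Node.
suff [Z [Zl Za Zs]] : exists Z : seq (seq nat * seq nat),
  [/\ size Z = survivors s.+1 d (Node l),
      all (fun z => [&& size z.1 == s.+1, size z.2 == s.+1 + d & prefix z.1 z.2]) Z &
      subseq (pair_flatten Z) (forest_vertices 0 l)].
  by exists Z; split=> //; apply: subseq_trans Zs (subseq_cons _ _).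
move: 0%N; elim: l => [|t l IHl] k; first by exists [::].
have [Z1 [l1 a1 s1]] := IH t; have [Z2 [l2 a2 s2]] := IHl k.+1.
exists ([seq (k :: z.1, k :: z.2) | z <- Z1] ++ Z2); split.
- by rewrite size_cat size_map l1 l2.
- rewrite all_cat a2 andbT all_map; apply: sub_all a1 => z /= /and3P[/eqP-> /eqP-> ->].
  by rewrite !eqxx.
- rewrite forest_vertices_cons pair_flatten_cat; apply: cat_subseq s2.
  have -> : pair_flatten [seq (k :: z.1, k :: z.2) | z <- Z1]
            = map (cons k) (pair_flatten Z1).
    by rewrite /pair_flatten map_flatten -!map_comp.
  exact: map_subseq.
Qed.

(** * Generations of a Cannings tree as forests *)

Definition generation (q : nat -> nat) (nu : nat -> nat -> nat) (s m : nat)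
  : seq otree :=
  foldr (fun s next => map Node (reshape (mkseq (nu s) (q s)) next))
        [::] (iota s m).

Lemma generationS q nu s m :
  generation q nu s m.+1 =
  map Node (reshape (mkseq (nu s) (q s)) (generation q nu s.+1 m)).
Proof. by []. Qed.

Section cannings.
Variables (h : nat) (q : nat -> nat) (nu : nat -> nat -> nat).
Hypothesis nu_sum :
  forall s, (0 < s)%N -> (s.+1 < h)%N -> sumn (mkseq (nu s) (q s)) = q s.+1.

Lemma size_generation s m : size (generation q nu s m.+1) = q s.
Proof. by rewrite generationS size_map size_reshape size_mkseq. Qed.

(** [reshape] drops nothing when the offspring numbers sum to the size of the next generation; for
    [m = 0] the next forest is empty. *)
Lemma generation_flatten s m : (0 < s)%N -> (s + m.+1 = h)%N ->
  flatten (reshape (mkseq (nu s) (q s)) (generation q nu s.+1 m)) =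
  generation q nu s.+1 m.
Proof.
move=> s0 sm; apply: reshapeKr; case: m sm => [//|m] sm.
by rewrite size_generation nu_sum //; lia.
Qed.

Lemma survivors_generation s m d : (0 < s)%N -> (s + m.+1 = h)%N ->
  sumn (map (survivors s.-1 d) (generation q nu 1 h.-1)) =
  count (reaches d) (generation q nu s m.+1).
Proof.
move=> s0 sm; rewrite -(sumn_count (reaches d)).
(* Once [k] levels are stripped off, the vertices sought lie [s.-1 - k] levels into the trees of
   generation [k.+1]; [k = s.-1] is the goal. *)
suff H k i : (k <= s.-1)%N -> k + i = h.-1 ->
    sumn (map (survivors s.-1 d) (generation q nu 1 h.-1)) =
    sumn (map (survivors (s.-1 - k) d) (generation q nu k.+1 i)).
  by rewrite (H s.-1 m.+1) ?subnn ?prednK //; lia.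
elim: k i => [|k IH] i ki kih; first by rewrite subn0 -kih.
rewrite (IH i.+1) ?generationS; [|lia|lia].
have -> : (s.-1 - k = (s.-1 - k.+1).+1)%N by lia.
rewrite -map_comp.
have -> : (survivors (s.-1 - k.+1).+1 d \o Node) =
          (sumn \o map (survivors (s.-1 - k.+1) d)) by [].
by rewrite map_comp -sumn_flatten -map_flatten generation_flatten //; lia.
Qed.

Lemma size_vertices_generation s m : (0 < s)%N -> s + m = h ->
  sumn (map (size \o vertices) (generation q nu s m)) = \sum_(s <= i < h) q i.
Proof.
elim: m s => [|m IH] s s0 sm.
  by rewrite -sm addn0 big_geq.
rewrite big_ltn; last lia.
rewrite -(IH s.+1) //; last lia.
rewrite generationS -[in RHS]generation_flatten // map_flatten sumn_flatten.
have E L : sumn (map (size \o vertices) (map Node L)) =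
           (size L + sumn (map (sumn \o map (size \o vertices)) L))%N.
  by elim: L => //= l L ->; rewrite size_forest_vertices; lia.
by rewrite E size_reshape size_mkseq -map_comp.
Qed.

Lemma size_vertices_cannings : (0 < h)%N ->
  size (vertices (cannings_tree h q nu)) = (\sum_(1 <= i < h) q i).+1.
Proof.
move=> h0; rewrite /cannings_tree vertices_Node /= size_forest_vertices.
by rewrite -(@size_vertices_generation 1 h.-1) //; lia.
Qed.

End cannings.

(* The types of the children, in order, when the i-th of the parents has type
   l_i and sh_i children. *)
Definition inherit {T : Type} (sh : seq nat) (l : seq T) : seq T :=
  flatten [seq nseq p.1 p.2 | p <- zip sh l].

Lemma size_inherit (T : Type) sh (l : seq T) : size sh = size l ->
  size (inherit sh l) = sumn sh.
Proof.
by elim: sh l => [|c sh IH] [|x l] //= [/IH E]; rewrite size_cat size_nseq E.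
Qed.

(** Children carry the type of their parent, so moving marks from children back to their parents
    keeps the set of marked types. *)
Lemma mask_inherit (T : eqType) sh (a : bitseq) (l : seq T) :
  size sh = size l -> size a = sumn sh ->
  mask [seq has id b | b <- reshape sh a] l =i mask a (inherit sh l).
Proof.
elim: sh a l => [|c sh IH] a [|x l] //=; first by move=> _ /size0nil->.
move=> [El] Ea y.
rewrite -[in RHS](cat_take_drop c a) mask_cat; last first.
  by rewrite size_takel ?size_nseq // Ea leq_addr.
rewrite mem_cat -IH //; last by rewrite size_drop Ea addKn.
move: (mask (map _ _) l) => B /=.
have : size (take c a) = c by rewrite size_takel // Ea leq_addr.
move: (take c a) => b <-.
have -> : (y \in mask b (nseq (size b) x)) = has id b && (y == x).
  elim: b => [|[] b IHb] //=; rewrite inE IHb.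
  by case: eqP => //=; rewrite ?andbF.
by case: (has id b); rewrite ?inE.
Qed.

(** Labels are positions in generation [s], passed on forward in time: each list depends on the
    previous one and on one more generation of offspring, whereas [reaches] looks into the
    future. *)
Fixpoint ancestors (q : nat -> nat) (nu : nat -> nat -> nat) (s m : nat) : seq nat :=
  if m is m'.+1 then
    inherit (mkseq (nu (s + m')%N) (q (s + m')%N)) (ancestors q nu s m')
  else iota 0 (q s).

(** * Counting surviving families by ancestral labels *)

Section survivors_labels.
Variables (h : nat) (q : nat -> nat) (nu : nat -> nat -> nat).
Hypothesis nu_sum :
  forall s, (0 < s)%N -> (s.+1 < h)%N -> sumn (mkseq (nu s) (q s)) = q s.+1.

Lemma size_ancestors s m : (0 < s)%N -> (s + m < h)%N ->
  size (ancestors q nu s m) = q (s + m)%N.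
Proof.
move=> s0; elim: m => [|m IH] sm; first by rewrite size_iota addn0.
rewrite size_inherit ?nu_sum ?addnS //; [lia|lia|].
by rewrite size_mkseq IH; lia.
Qed.

Lemma reaches_generation s m d :
  map (reaches d.+1) (generation q nu s m.+1) =
  [seq has id b | b <- reshape (mkseq (nu s) (q s))
                               (map (reaches d) (generation q nu s.+1 m))].
Proof.
rewrite generationS -map_reshape -!map_comp; apply: eq_map => l /=.
by elim: l => //= t l ->.
Qed.

(** Mark the individuals of generation [s + k] with a descendant in generation [s + d]. The set of
    marked labels does not depend on [k]: for [k = 0] it is the set of surviving founders, and for
    [k = d] everybody is marked. *)
Lemma ancestors_survivors s d : (0 < s)%N -> (s + d).+1 = h ->
  count (reaches d) (generation q nu s d.+1) = size (undup (ancestors q nu s d)).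
Proof.
move=> s0 sd.
pose a k := map (reaches (d - k)) (generation q nu (s + k) (d - k).+1).
have sa k : (k <= d)%N -> size (a k) = q (s + k)%N.
  by move=> kd; rewrite size_map size_generation.
have H k : (k <= d)%N -> mask (a 0%N) (iota 0 (q s)) =i mask (a k) (ancestors q nu s k).
  elim: k => [//|k IH] kd y; rewrite {}IH; last lia.
  rewrite /a -(subnSK kd) reaches_generation mask_inherit ?addnS //.
  - by rewrite size_mkseq size_ancestors; lia.
  - by rewrite size_map size_generation nu_sum; lia.
have am : mask (a d) (ancestors q nu s d) = ancestors q nu s d.
  have -> : a d = nseq (size (a d)) true.
    by rewrite /a subnn; elim: (generation _ _ _ _) => //= t l {1}->.
  by apply: mask_true; rewrite sa // size_ancestors; lia.
have := H d (leqnn _); rewrite am => {}H.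
have u : uniq (mask (a 0%N) (iota 0 (q s))) by rewrite mask_uniq ?iota_uniq.
rewrite -(undup_id u) in H.
have -> : size (undup (ancestors q nu s d)) = size (mask (a 0%N) (iota 0 (q s))).
  apply/perm_size/uniq_perm; rewrite ?undup_uniq // => x.
  by rewrite mem_undup -H undup_id.
rewrite size_mask; last by rewrite size_iota sa ?addn0.
by rewrite /a addn0 subn0 count_map.
Qed.

Lemma cannings_survivors s d : (0 < s)%N -> (s + d).+1 = h ->
  survivors s d (cannings_tree h q nu) = size (undup (ancestors q nu s d)).
Proof.
move=> s0 sd; rewrite -ancestors_survivors // -(survivors_generation nu_sum) //; last by rewrite -sd addnS.
by case: s s0 sd => [//|s] _ sd.
Qed.

End survivors_labels.

(** * Distance from an unsampled subtree to the sample *)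

(** A step changes the height by one, and the subtree rooted at [a] can be left only from [a] to its
    parent. *)
Lemma path_leaving_subtree t (a : seq nat) (u : vertex t) (p : seq (vertex t)) :
  path Defs.adjacent u p -> prefix a (val u) -> ~~ prefix a (val (last u p)) ->
  (size (val u) < size p + size a)%N.
Proof.
elim: p u => [|x p IH] u /=; first by move=> _ ->.
move=> /andP[ux xp] au al.
have [ax|nax] := boolP (prefix a (val x)).
  have IHx := IH x xp ax al.
  by case/orP: ux => /andP[/eqP E _]; move: E IHx; rewrite /=; lia.
case/orP: ux => /andP[/eqP E /prefixP[b Eb]].
  by move: nax; rewrite Eb (prefix_trans au) // prefix_prefix.
have : (size (val x) < size a)%N.
  rewrite ltnNge; apply/negP => ax; move/negP: nax; apply.
  move/prefixP: au => [c Ec]; move: Ec Eb => /= ->  Eb.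
  have := congr1 (take (size a)) Eb; rewrite take_size_cat // takel_cat // => ->.
  by apply/prefixP; exists (drop (size a) (val x)); rewrite cat_take_drop.
by rewrite E; lia.
Qed.

(** The [minn] absorbs the default value [#|vertex t|] that [find] returns when no length works, so
    connectedness need not be discussed. *)
Lemma gdist_leaving_subtree t (a : seq nat) (u v : vertex t) :
  prefix a (val u) -> ~~ prefix a (val v) ->
  (minn (size (val u) - size a).+1 #|vertex t| <= gdist u v)%N.
Proof.
move=> au av; rewrite leqNgt /gdist; set P := (P in find P).
apply/negP; rewrite leq_min => /andP[m1 m2].
have := m2; rewrite -{2}(size_iota 0 #|vertex t|) -has_find => /(nth_find 0%N).
rewrite nth_iota // add0n => /existsP[p /andP[pp /eqP pl]].
have := path_leaving_subtree pp au; rewrite pl => /(_ av); rewrite size_tuple.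
have : (size a <= size (val u))%N by move/prefixP: au => [c ->]; rewrite size_cat leq_addr.
move: m1 {m2}; set m := find _ _; lia.
Qed.

(** Pigeonhole: the first [k] sampled vertices have at most [k] ancestors at height [s], so some
    surviving vertex [z.1] has no sampled descendant. The spanned subtree avoids the subtree rooted
    at [z.1] (the root does since [0 < s]), and [z.2] lies [d] levels inside. *)
Lemma Delta_ge_survivors t (k s d : nat) (pi : {perm 'I_#|vertex t|}) :
  (0 < s)%N -> (0 < d)%N -> (k < survivors s d t)%N ->
  (minn d.+1 #|vertex t| <= Delta pi k)%N.
Proof.
move=> s0 d0 kK; have [Z [sZ /allP aZ zZ]] := survivors_subseq s t d0.
have fst_sub : subseq (map fst Z) (vertices t).
  apply: subseq_trans zZ; elim: (Z) => //= z Z' IH; rewrite eqxx.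
  by apply: subseq_trans IH (subseq_cons _ _).
have uZ : uniq (map fst Z) by apply: subseq_uniq fst_sub (vertices_uniq t).
(* Truncating an address to length [s] gives the ancestor at height [s]; shorter addresses stay
   whole, which does no harm. *)
pose hit := [seq take s (val (V_ pi j)) | j : 'I_#|vertex t| <- enum 'I_#|vertex t| & (j < k)%N].
have sh : (size hit <= k)%N.
  rewrite size_map size_filter.
  have -> : count (fun j : 'I_#|vertex t| => (j < k)%N) (enum 'I_#|vertex t|)
          = count (fun i => (i < k)%N) (iota 0 #|vertex t|).
    by rewrite -val_enum_ord count_map.
  rewrite -size_filter -[leqRHS](size_iota 0 k).
  apply: uniq_leq_size; first by rewrite filter_uniq // iota_uniq.
  by move=> i; rewrite mem_filter !mem_iota => /andP[].
have [z zZ' zh] : exists2 z, z \in Z & z.1 \notin hit.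
  apply/hasP; apply: contraLR kK => /hasPn H.
  rewrite -leqNgt -sZ -(size_map fst); apply: leq_trans sh.
  by apply: uniq_leq_size => // x /mapP[z /H/negPn + ->].
have /and3P[/eqP z1 /eqP z2 z12] := aZ _ zZ'.
have zv : z.2 \in vertices t.
  apply: (mem_subseq zZ); apply/flattenP; exists [:: z.1; z.2].
    by apply/mapP; exists z.
  by rewrite !inE eqxx orbT.
pose v : vertex t := SeqSub zv.
apply: leq_trans (leq_bigmax v).
elim/big_ind: _ => [|x y Hx Hy|u uS]; [exact: geq_minr|by rewrite leq_min Hx|].
have nu : ~~ prefix z.1 (val u).
  apply/negP => zu; case/orP: uS => [/eqP u0|/existsP[j /andP[jk uj]]].
    by move: zu; rewrite u0 prefixs0 => /eqP z0; rewrite z0 in z1; rewrite -z1 in s0.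
  move/negP: zh; apply; apply/mapP; exists j; first by rewrite mem_filter jk mem_enum.
  have /prefixP[c ->] := prefix_trans zu uj.
  by rewrite -z1 take_size_cat.
have := gdist_leaving_subtree (u := v) (v := u) z12 nu.
by rewrite /= z1 z2 addKn.
Qed.

(** * The number of surviving families *)

Local Open Scope ring_scope.

(** Double counting: a set of [a.+1] elements arises in [a.+1] ways by adding a point to a set of
    [a] elements. *)
Lemma sum_card_succ_sets (R : pzRingType) (T : finType) (a : nat) (g : {set T} -> R) :
  a.+1%:R * \sum_(B : {set T} | #|B| == a.+1) g B =
  \sum_(A : {set T} | #|A| == a) \sum_(x | x \notin A) g (x |: A)%SET.
Proof.
rewrite mulr_sumr (exchange_big_dep predT) //=.
rewrite (eq_bigr (fun B : {set T} => \sum_(x | x \in B) g B)); last first.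
  by move=> B /eqP <-; rewrite sumr_const mulr_natl.
rewrite (exchange_big_dep predT) //=; apply: eq_bigr => x _.
rewrite (reindex_onto (fun A => x |: A)%SET (fun B => B :\ x)%SET) /=; last first.
  by move=> B /andP[_ xB]; rewrite finset.setD1K.
apply: eq_bigl => A; rewrite setU11 andbT cardsU1 .
case: (boolP (x \in A)) => xA /=.
  rewrite andbF; apply/negP => /andP[_ /eqP E].
  by move: xA; rewrite -E !inE eqxx.
by rewrite add1n eqSS setU1K // eqxx.
Qed.

(** Let [y = #|S :\: A|] and [m = #|T| - #|A|]. The summand is [1 / y] for [y] points and
    [1 / (1 + y)] for the other [m - y], with total [(m + 1) / (1 + y)] exactly when [0 < y], and
    [m] when [y = 0]. This exactness is why the weight [1 / (1 + K)] is used. *)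
Lemma sum_survivors_step (R : realFieldType) (T : finType) (S A : {set T}) :
  \sum_(x | x \notin A) (1 + #|S :\: (x |: A)|%:R)^-1 <=
  (#|T|.+1 - #|A|)%:R / (1 + #|S :\: A|%:R) :> R.
Proof.
pose y := #|S :\: A|.
rewrite (bigID (mem S)) /=.
rewrite (eq_bigr (fun=> (y%:R : R)^-1)); last first.
  move=> x /andP[xA xS]; congr (_^-1).
  have -> : y = (1 + #|S :\: (x |: A)|)%N.
    rewrite /y (cardsD1 x (S :\: A)) inE xS xA; congr (_ + #|pred_of_set _|)%N.
    by apply/setP => z; rewrite !inE negb_or andbA.
  by rewrite natrD.
rewrite [X in _ + X](eq_bigr (fun=> (1 + y%:R : R)^-1)); last first.
  move=> x /andP[xA xS]; congr ((1 + #|pred_of_set _|%:R)^-1).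
  apply/setP => z; rewrite !inE negb_or.
  by case: eqP => [->|//]; rewrite (negbTE xS) !andbF.
rewrite !sumr_const.
have c1 : #|[pred x | (x \notin A) && (x \in S)]| = y.
  by apply: eq_card => x; rewrite !inE.
have c2 : #|[pred x | (x \notin A) && (x \notin S)]| = (#|T| - #|A| - y)%N.
  rewrite -(cardC (mem A)) addKn -[y]c1.
  rewrite -(cardID (mem S) [predC A]).
  rewrite [X in (X + _ - _)%N](_ : _ = #|[pred x | (x \notin A) && (x \in S)]|).
    rewrite addKn; apply: eq_card => x; rewrite !inE; exact: andbC.
  by apply: eq_card => x; rewrite !inE.
rewrite [X in _ *+ X + _]c1 [X in _ + _ *+ X]c2.
have yT : (y <= #|T| - #|A|)%N.
  rewrite -[X in (_ <= X - _)%N](cardC (mem A)) addKn -c1.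
  by apply/subset_leq_card/fintype.subsetP => x; rewrite !inE => /andP[].
rewrite subSn; last exact: max_card.
move: (#|T| - #|A|)%N yT => m ym.
rewrite -(mulr_natr _^-1 y) -(mulr_natr _ (m - y)) -/y natrB // (_ : m.+1%:R = 1 + m%:R :> R); last by rewrite -natr1 addrC.
have : y%:R <= m%:R :> R by rewrite ler_nat.
have y1 : 0 < 1 + y%:R :> R by rewrite ltr_pwDl.
have [->|y0] := posnP y.
  by rewrite subr0 mulr0 add0r addr0 invr1 ?mul1r ?mulr1 => _; lra.
move=> _; have y0' : y%:R != 0 :> R by rewrite pnatr_eq0 -lt0n.
rewrite le_eqVlt; apply/orP; left; apply/eqP; field.
by rewrite y0' gt_eqF.
Qed.

(** The killed set is built one point at a time; the factors [#|T|.+1 - a] of the one-point bound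
    multiply up to the binomial coefficient. *)
Lemma sum_survivors (R : realFieldType) (T : finType) (S : {set T}) (a : nat) :
  (a <= #|T|)%N ->
  \sum_(A : {set T} | #|A| == a) (1 + #|S :\: A|%:R)^-1 <=
  'C(#|T|.+1, a)%:R / (1 + #|S|%:R) :> R.
Proof.
elim: a => [_|a IH aT].
  rewrite (big_pred1 finset.set0) => [|A]; last by rewrite cards_eq0.
  by rewrite finset.setD0 bin0 mul1r.
have a0 : 0 < a.+1%:R :> R by rewrite ltr0n.
rewrite -(ler_pM2l a0) sum_card_succ_sets mulrA -natrM mul_bin_left natrM -mulrA.
apply: le_trans (ler_wpM2l _ (IH (ltnW aT))); last by [].
rewrite mulr_sumr; apply: ler_sum => A /eqP cA.
by rewrite -cA; exact: sum_survivors_step.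
Qed.

Lemma sum_option (R : nmodType) (T : finType) (F : option T -> R) :
  \sum_o F o = F None + \sum_x F (Some x).
Proof.
rewrite (bigD1 None) //=; congr (_ + _).
rewrite (reindex_omap Some id) => [|[x|]] //=.
by apply: eq_bigl => x; rewrite eqxx.
Qed.

(** * Law of the offspring of one generation *)

Section draw.
Context {R : realType} (beta : R) (n : nat).
Hypothesis r_gt0 : (0 < r_ beta n)%N.
Hypothesis r_le : (r_ beta n <= n)%N.
Local Notation r := (r_ beta n).
Local Notation p := (p_ beta n).

(** Off this set a draw has mass 0, and its offspring numbers need not sum to [n]. *)
Definition proper_draw (o : draw n) : bool :=
  if o is Some (i0, A) then (i0 \notin A) && (#|A| == r.-1) else true.

Lemma draw_pmf_improper o : ~~ proper_draw o -> draw_pmf beta o = 0.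
Proof. by case: o => [[i0 A]|//] /= /negbTE->. Qed.

(* Summing over the position of the large family turns the law of the set of
   childless individuals into the uniform law. *)
Lemma sum_draw_pmf (f : option {set 'I_n} -> R) :
  \sum_(o : draw n) draw_pmf beta o * f (omap snd o) =
  (1 - p) * f None +
  p / 'C(n, r.-1)%:R * \sum_(A : {set 'I_n} | #|A| == r.-1) f (Some A).
Proof.
rewrite sum_option /=; congr (_ + _).
rewrite (eq_bigr (fun x : 'I_n * {set 'I_n} =>
  if (x.1 \notin x.2) && (#|x.2| == r.-1)
  then p / n%:R / 'C(n.-1, r.-1)%:R * f (Some x.2) else 0)); last first.
  by move=> [i A] _ /=; case: ifP => //; rewrite mul0r.
rewrite -(pair_bigA _ (fun (i : 'I_n) (A : {set 'I_n}) => if (i \notin A) && (#|A| == r.-1)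
  then p / n%:R / 'C(n.-1, r.-1)%:R * f (Some A) else 0)) /=.
rewrite exchange_big /= mulr_sumr [RHS]big_mkcond /=; apply: eq_bigr => A _.
case: ifP => [/eqP cA|]; last by rewrite big1 // => i _; rewrite andbF.
rewrite -big_mkcond /= (eq_bigl (fun i => i \in (~: A)%SET)); last first.
  by move=> i; rewrite !inE andbT.
rewrite sumr_const.
have -> : #|(~: A)%SET| = (n - r.-1)%N by rewrite cardsCs finset.setCK card_ord cA.
rewrite -(mulr_natl _ (n - r.-1)) mulrA; congr (_ * _).
have n0 : (0 < n)%N by apply: leq_trans r_le.
have e1 : (n * 'C(n.-1, r.-1) = (n - r.-1) * 'C(n, r.-1))%N.
  by rewrite mul_bin_diag mul_bin_left.
have c1 : 'C(n.-1, r.-1)%:R != 0 :> R by rewrite pnatr_eq0 -lt0n bin_gt0; lia.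
have c2 : 'C(n, r.-1)%:R != 0 :> R by rewrite pnatr_eq0 -lt0n bin_gt0; lia.
have n0' : n%:R != 0 :> R by rewrite pnatr_eq0 -lt0n.
have {}e1 : n%:R * 'C(n.-1, r.-1)%:R = (n - r.-1)%:R * 'C(n, r.-1)%:R :> R.
  by rewrite -!natrM e1.
apply: (mulIf (mulf_neq0 (mulf_neq0 n0' c1) c2)).
transitivity (p * ((n - r.-1)%:R * 'C(n, r.-1)%:R)); first by field; rewrite n0' c1.
by rewrite -e1; field.
Qed.

Lemma sum_draw_pmf1 : \sum_(o : draw n) draw_pmf beta o = 1.
Proof.
have /= := sum_draw_pmf (fun=> 1).
rewrite (eq_bigr (draw_pmf beta (n := n))) => [->|o _]; last by rewrite mulr1.
rewrite sumr_const mulr1.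
have -> : #|[pred A : {set 'I_n} | #|A| == r.-1]| = 'C(n, r.-1).
  by have := card_draws 'I_n r.-1; rewrite card_ord => <-; apply: eq_card => A; rewrite !inE.
rewrite divfK ?subrK // pnatr_eq0 -lt0n bin_gt0; lia.
Qed.

Lemma sumn_nu_of o : proper_draw o ->
  sumn [seq nu_of beta o i | i <- enum 'I_n] = n.
Proof.
rewrite sumnE big_map big_enum /=; case: o => [[i0 A]|] /=; last first.
  by rewrite sum1_card card_ord.
case/andP=> i0A /eqP cA; rewrite (bigD1 i0) //= eqxx.
rewrite (eq_bigr (fun i => (i \notin A) : nat)); last first.
  by move=> i /negbTE->; case: (i \in A).
rewrite -big_mkcondr sum1_card.
have := cardsC (i0 |: A)%SET; rewrite cardsU1 i0A cA card_ord /= => E.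
rewrite -[RHS]E; congr addn; first lia.
by apply: eq_card => i; rewrite !inE negb_or.
Qed.

Definition reproduce {T : Type} (o : draw n) (l : seq T) : seq T :=
  inherit [seq nu_of beta o i | i <- enum 'I_n] l.

End draw.

Lemma mem_inherit_enum (T : eqType) (n : nat) (f : 'I_n -> nat) (x0 : T) (l : seq T)
    (i : 'I_n) :
  size l = n -> (0 < f i)%N -> nth x0 l i \in inherit [seq f i | i <- enum 'I_n] l.
Proof.
move=> ln fi; rewrite -{2}(mkseq_nth x0 l) ln /mkseq -val_enum_ord -map_comp.
rewrite /inherit zip_map -map_comp; apply/flattenP.
exists (nseq (f i) (nth x0 l i)); last by rewrite mem_nseq fi eqxx.
by apply/mapP; exists i; rewrite ?mem_enum.
Qed.

(** The positions where a label occurs for the first time: one representative per family. *)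
Definition first_indices (T : eqType) (n : nat) (x0 : T) (l : seq T) : {set 'I_n} :=
  [set i : 'I_n | index (nth x0 l i) l == i]%SET.

Lemma size_undup_first_indices (T : eqType) (n : nat) (x0 : T) (l : seq T) :
  size l = n -> (size (undup l) <= #|first_indices n x0 l|)%N.
Proof.
move=> ln; rewrite cardE -(size_map (fun i : 'I_n => nth x0 l i)).
apply: uniq_leq_size (undup_uniq _) _ => x; rewrite mem_undup => xl.
have il : (index x l < n)%N by rewrite -ln index_mem.
apply/mapP; exists (Ordinal il); last by rewrite /= nth_index.
by rewrite mem_enum inE /= nth_index.
Qed.

(** * Expected weight after one generation *)

Section survival_bound.
Context {R : realType} (beta : R) (n : nat).
Hypothesis r_gt0 : (0 < r_ beta n)%N.
Hypothesis r_le : (r_ beta n <= n)%N.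
Hypothesis p_01 : 0 <= p_ beta n <= 1.
Local Notation r := (r_ beta n).
Local Notation p := (p_ beta n).

Definition label_weight (l : seq nat) : R := (1 + (size (undup l))%:R)^-1.

(** The quotient is ['C(n.+1, r.-1) / 'C(n, r.-1)], which bounds the growth of the weight in an
    event; it is averaged with the factor 1 of a generation without event. *)
Definition loss_factor : R := 1 + p * (n.+1%:R / (n.+2 - r)%:R - 1).

Lemma draw_pmf_ge0 (o : draw n) : 0 <= draw_pmf beta o.
Proof.
case/andP: p_01 => p0 p1; case: o => [[i A]|] /=; last by rewrite subr_ge0.
by case: ifP => // _; apply: divr_ge0 => //; apply: divr_ge0.
Qed.

(** A representative outside [A] has a child, since [r] is positive and the others have one each;
    distinct representatives carry distinct labels. *)
Lemma survivors_reproduce i0 (A : {set 'I_n}) (l : seq nat) : size l = n ->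
  i0 \notin A ->
  (#|first_indices n 0%N l :\: A| <= size (undup (reproduce beta (Some (i0, A)) l)))%N.
Proof.
move=> ln iA; rewrite cardE -(size_map (fun i : 'I_n => nth 0%N l i)).
apply: uniq_leq_size.
  rewrite map_inj_in_uniq ?enum_uniq // => i j; rewrite !mem_enum !inE.
  move=> /andP[_ /eqP iS] /andP[_ /eqP jS] E; apply: val_inj.
  by rewrite /= -iS E jS.
move=> x /mapP[i]; rewrite mem_enum !inE => /andP[iA' _] ->.
rewrite mem_undup; apply: mem_inherit_enum => //=.
by case: eqP => // _; rewrite (negbTE iA').
Qed.

Lemma label_weight_reproduce (l : seq nat) : size l = n ->
  \sum_(o : draw n) draw_pmf beta o * label_weight (reproduce beta o l) <=
  loss_factor * label_weight l.
Proof.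
move=> ln; pose S := first_indices n 0%N l.
(* [f] keeps only the representatives and sees a draw only through its childless set, so that
   [sum_draw_pmf] applies. *)
pose f (o : option {set 'I_n}) : R :=
  if o is Some A then (1 + #|S :\: A|%:R)^-1 else label_weight l.
have pos (m : nat) : 0 < 1 + m%:R :> R by rewrite ltr_pwDl.
apply: (@le_trans _ _ (\sum_(o : draw n) draw_pmf beta o * f (omap snd o))).
  apply: ler_sum => o _; have [oP|/draw_pmf_improper->] := boolP (proper_draw beta o);
    last by rewrite !mul0r.
  apply: ler_wpM2l; first exact: draw_pmf_ge0.
  case: o oP => [[i0 A]|] /=.
    case/andP=> iA _; rewrite lef_pV2 ?posrE // lerD2l ler_nat.
    exact: survivors_reproduce.
  move=> _; rewrite /reproduce (_ : inherit _ l = l) //.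
  rewrite -[l in inherit _ l](mkseq_nth 0%N l) ln /mkseq -val_enum_ord -map_comp.
  rewrite /inherit zip_map -map_comp -[RHS](mkseq_nth 0%N l) ln /mkseq -val_enum_ord.
  by elim: (enum 'I_n) => //= i s ->.
case/andP: p_01 => p0 p1.
rewrite sum_draw_pmf // /f.
have -> : loss_factor * label_weight l =
    (1 - p) * label_weight l + p * (n.+1%:R / (n.+2 - r)%:R * label_weight l).
  by rewrite /loss_factor; ring.
rewrite lerD2l -[p / _ * _]mulrA.
apply: ler_wpM2l => //.
have c0 : 0 < 'C(n, r.-1)%:R :> R by rewrite ltr0n bin_gt0; lia.
rewrite mulrC ler_pdivrMr //.
have rn : (r.-1 <= #|'I_n|)%N by rewrite card_ord; lia.
apply: le_trans (sum_survivors R S rn) _.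
have d0 : 0 < (n.+2 - r)%:R :> R by rewrite ltr0n; lia.
have E : 'C(n.+1, r.-1)%:R = n.+1%:R / (n.+2 - r)%:R * 'C(n, r.-1)%:R :> R.
  apply: (mulIf (lt0r_neq0 d0)); rewrite mulrAC divfK ?gt_eqF // -!natrM.
  congr (_%:R); have := mul_bin_down n.+1 r.-1; rewrite /= => ->.
  by rewrite mulnC; congr (_ * _)%N; lia.
rewrite card_ord E mulrAC; apply: ler_wpM2r; first exact: ltW.
apply: ler_wpM2l; first by rewrite divr_ge0.
by rewrite lef_pV2 ?posrE // lerD2l ler_nat size_undup_first_indices.
Qed.

End survival_bound.

(** * Resampling one coordinate of a product law *)

Section resample.
Variables (R : comPzRingType) (I D : finType) (P : D -> R).

Definition update (w : {ffun I -> D}) (j : I) (o : D) : {ffun I -> D} :=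
  [ffun i => if i == j then o else w i].

Lemma prod_update (w : {ffun I -> D}) j o :
  (\prod_i P (update w j o i)) * P (w j) = (\prod_i P (w i)) * P o.
Proof.
rewrite (bigD1 j) //= [in RHS](bigD1 j) //= ffunE eqxx.
rewrite mulrAC [RHS]mulrAC; congr (_ * _); first exact: mulrC.
by apply: eq_bigr => i /negbTE ij; rewrite ffunE ij.
Qed.

Hypothesis P1 : \sum_o P o = 1.

(** This replaces conditioning on the coordinates other than [j]: adjoin an independent copy [o] and
    exchange it with [w j], an involution that preserves the product weight. *)
Lemma resample (G : {ffun I -> D} -> R) (j : I) :
  \sum_(w : {ffun I -> D}) (\prod_i P (w i)) * G w =
  \sum_(w : {ffun I -> D}) (\prod_i P (w i)) * \sum_o P o * G (update w j o).
Proof.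
transitivity (\sum_(x : {ffun I -> D} * D)
                (\prod_i P (x.1 i)) * P x.2 * G x.1).
  rewrite -(pair_bigA _ (fun (w : {ffun I -> D}) (o : D) => (\prod_i P (w i)) * P o * G w)) /=.
  apply: eq_bigr => w _; rewrite -mulr_suml -mulr_sumr P1 mulr1 //.
rewrite (reindex_inj (h := fun x : {ffun I -> D} * D => (update x.1 j x.2, x.1 j))) /=; last first.
  apply: (can_inj (g := fun x : {ffun I -> D} * D => (update x.1 j x.2, x.1 j))) => -[w o] /=.
  congr pair; last by rewrite ffunE eqxx.
  by apply/ffunP => i; rewrite !ffunE; case: eqP => [->|].
rewrite (eq_bigr (fun x : {ffun I -> D} * D => (\prod_i P (x.1 i)) * P x.2 * G (update x.1 j x.2)));
  last by move=> x _; rewrite prod_update.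
rewrite -(pair_bigA _ (fun (w : {ffun I -> D}) (o : D) => (\prod_i P (w i)) * P o * G (update w j o))) /=.
by apply: eq_bigr => w _; rewrite mulr_sumr; apply: eq_bigr => o _; rewrite mulrA.
Qed.

End resample.

(** * Expected weight along the generations *)

Section expectation.
Context {R : realType} (beta : R) (n : nat).
Hypothesis r_gt0 : (0 < r_ beta n)%N.
Hypothesis r_le : (r_ beta n <= n)%N.

Definition proper_draws (w : draws n) : bool := [forall j, proper_draw beta (w j)].

Lemma draws_pmf_improper w : ~~ proper_draws w -> draws_pmf beta w = 0.
Proof.
rewrite negb_forall => /existsP[j jw].
by rewrite /draws_pmf (bigD1 j) //= (draw_pmf_improper jw) mul0r.
Qed.

Lemma E_cst (c : R) : E_ beta (n := n) (fun=> c) = c.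
Proof.
rewrite /E_ -mulr_suml -[RHS]mul1r; congr (_ * _).
rewrite -[LHS](bigA_distr_bigA (fun (j : 'I_n.-1) (o : draw n) => draw_pmf beta o)).
by rewrite big1 // => j _; exact: sum_draw_pmf1.
Qed.

Lemma E_affine (a b : R) (X : draws n -> R) :
  E_ beta (fun w : draws n => a + b * X w) = a + b * E_ beta X.
Proof.
rewrite -[a in RHS]E_cst /E_ mulr_sumr -big_split /=; apply: eq_bigr => w _.
by rewrite mulrDr; congr (_ + _); rewrite mulrCA.
Qed.

Lemma mkseq_offspring (w : draws n) (j : 'I_n.-1) :
  mkseq (offspring beta w j.+1) n = [seq nu_of beta (w j) i | i <- enum 'I_n].
Proof.
rewrite /mkseq -val_enum_ord -map_comp; apply: eq_map => i /=.
by rewrite /offspring !valK.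
Qed.

Lemma sumn_offspring (w : draws n) : proper_draws w -> forall s, (0 < s)%N -> (s < n)%N ->
  sumn (mkseq (offspring beta w s) (q_ n s)) = q_ n s.+1.
Proof.
move=> /forallP wP [//|s] _ sn; have sn' : (s < n.-1)%N by lia.
rewrite /q_ !ifT; [|lia|lia].
by rewrite (mkseq_offspring w (Ordinal sn')) sumn_nu_of.
Qed.

Local Notation anc w := (ancestors (q_ n) (offspring beta w)).

Lemma ancestorsS s m (w : draws n) (j : 'I_n.-1) : (s + m)%N = j.+1 ->
  anc w s m.+1 = reproduce beta (w j) (anc w s m).
Proof.
move=> E /=; rewrite E /q_ ifT ?mkseq_offspring //.
by case: j E => j /= jn _; lia.
Qed.

(** Draw [j] gives the offspring of generation [j.+1], so it affects labels only from generation
    [j.+2] on. *)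
Lemma ancestors_update s m (w : draws n) (j : 'I_n.-1) o : (0 < s)%N -> (s + m <= j.+1)%N ->
  anc (update w j o) s m = anc w s m.
Proof.
move=> s0; elim: m => [//|m IH] smj.
have kn : ((s + m).-1 < n.-1)%N by have := ltn_ord j; lia.
have E : (s + m)%N = (Ordinal kn).+1 by rewrite /= prednK // addn_gt0 s0.
rewrite !(ancestorsS _ E) IH; last lia.
congr reproduce; rewrite ffunE ifF //; apply/negP => /eqP/(congr1 val) /= Ej.
by move: smj; rewrite -Ej; lia.
Qed.

Lemma size_anc (w : draws n) s m : proper_draws w -> (0 < s)%N -> (s + m <= n)%N ->
  size (anc w s m) = n.
Proof.
move=> wP s0 smn; rewrite (@size_ancestors n.+1) //.
- by rewrite /q_ ifT //; lia.
- by move=> k k0 kn; apply: sumn_offspring.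
Qed.

Hypothesis p_01 : 0 <= p_ beta n <= 1.

Lemma draws_pmf_ge0 (w : draws n) : 0 <= draws_pmf beta w.
Proof. by apply: prodr_ge0 => j _; exact: draw_pmf_ge0. Qed.

Lemma E_le (X Y : draws n -> R) :
  (forall w, proper_draws w -> X w <= Y w) -> E_ beta X <= E_ beta Y.
Proof.
move=> XY; apply: ler_sum => w _.
have [wP|/draws_pmf_improper->] := boolP (proper_draws w); last by rewrite !mul0r.
by apply: ler_wpM2l (XY _ wP); exact: draws_pmf_ge0.
Qed.

Lemma loss_factor_ge0 : 0 <= loss_factor beta n.
Proof.
case/andP: p_01 => p0 p1; rewrite /loss_factor addr_ge0 // mulr_ge0 // subr_ge0.
by rewrite ler_pdivlMr ?mul1r ?ler_nat ?ltr0n; lia.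
Qed.

(** Initially the [n] labels are distinct and [1 / (1 + n) <= 1 / n]. For each further generation,
    its draw is resampled while the labels so far stay fixed, which costs one [loss_factor]. *)
Lemma E_label_weight s m : (0 < s)%N -> (s + m <= n)%N ->
  E_ beta (fun w : draws n => label_weight (anc w s m)) <= loss_factor beta n ^+ m / n%:R.
Proof.
move=> s0; elim: m => [|m IH] smn.
  rewrite [X in X <= _](_ : _ = (1 + n%:R)^-1).
    by rewrite expr0 mul1r lef_pV2 ?posrE ?lerDr ?ltr_pwDl // ltr0n; lia.
  rewrite -[RHS]E_cst /E_; apply: eq_bigr => w _; congr (_ * _).
  by rewrite /label_weight /= undup_id ?iota_uniq // size_iota /q_ ifT //; lia.
rewrite exprS -mulrA.
apply: le_trans (ler_wpM2l loss_factor_ge0 (IH _)); last lia.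
have kn : ((s + m).-1 < n.-1)%N by lia.
pose j := Ordinal kn; have E : (s + m)%N = j.+1 by rewrite /= prednK // addn_gt0 s0.
rewrite /E_ (resample (sum_draw_pmf1 r_gt0 r_le) _ j).
have -> : loss_factor beta n * \sum_(w : draws n) draws_pmf beta w * label_weight (anc w s m)
  = E_ beta (fun w : draws n => loss_factor beta n * label_weight (anc w s m)).
  by rewrite /E_ mulr_sumr; apply: eq_bigr => w _; rewrite mulrCA.
apply: (@E_le (fun w : draws n => \sum_o draw_pmf beta o * label_weight (anc (update w j o) s m.+1))).
move=> w wP.
rewrite (eq_bigr (fun o => draw_pmf beta o *
    label_weight (reproduce beta o (anc w s m)))); last first.
  move=> o _; rewrite (ancestorsS _ E) ancestors_update ?E //.
  by rewrite ffunE eqxx.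
by apply: label_weight_reproduce => //; apply: size_anc => //; lia.
Qed.

(** A Markov inequality: pointwise [X >= a * (1 - k / (1 + K))], where [K] is the number of labels.
    If [K >= k] this follows from [X >= a]; otherwise [1 + K <= k] and the right-hand side is at
    most 0. *)
Lemma E_ge_survivors (X : draws n -> R) (a : R) (s d k : nat) :
  0 <= a -> (0 < s)%N -> (s + d)%N = n ->
  (forall w, 0 <= X w) ->
  (forall w, proper_draws w -> (k <= survivors s d (tree_ beta w))%N -> a <= X w) ->
  a * (1 - k%:R * (loss_factor beta n ^+ d / n%:R)) <= E_ beta X.
Proof.
move=> a0 s0 sdn X0 Xa.
apply: (@le_trans _ _ (E_ beta (fun w : draws n => a + - (a * k%:R) * label_weight (anc w s d)))).
  rewrite E_affine mulrDr mulr1 mulrN lerD2l mulNr lerN2 -mulrA.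
  by do 2!apply: ler_wpM2l => //; apply: E_label_weight; rewrite ?sdn.
apply: E_le => w wP; rewrite mulNr -mulrA.
have l0 : 0 <= label_weight (anc w s d) :> R by rewrite invr_ge0 addr_ge0.
have [ka|ak] := leqP k (size (undup (anc w s d))).
  apply: (@le_trans _ _ a); first by rewrite lerBlDr lerDl !mulr_ge0.
  apply: Xa => //; rewrite (@cannings_survivors n.+1) ?sdn //.
  by move=> i i0 iN; exact: sumn_offspring.
apply: le_trans (X0 w); rewrite subr_le0 ler_peMr //.
rewrite ler_pdivlMr ?ltr_pwDl // mul1r -[1]/(1%:R) -natrD ler_nat; exact: ak.
Qed.

End expectation.

(** * Size of the model tree and lower bound on [Delta] *)

Section Cannings_tree.
Context {R : realType} (beta : R) (n : nat).
Hypothesis n0 : (0 < n)%N.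
Hypothesis r_gt0 : (0 < r_ beta n)%N.
Hypothesis r_le : (r_ beta n <= n)%N.

Lemma size_vertices_tree (w : draws n) : proper_draws beta w ->
  size (vertices (tree_ beta w)) = (n * n)%N.+1.
Proof.
move=> wP; rewrite size_vertices_cannings //; last first.
    by move=> s s1 sn; apply: sumn_offspring.
congr _.+1; rewrite (eq_big_nat _ _ (F2 := fun=> n)).
  by rewrite sum_nat_const_nat; lia.
by move=> i /andP[i0 iN]; rewrite /q_ ifT //; lia.
Qed.

Lemma card_vertex t : #|vertex t| = size (vertices t).
Proof. by rewrite card_seq_sub // vertices_uniq. Qed.

Lemma Delta_tree_ge (w : draws n) (s d k : nat) pi : proper_draws beta w ->
  (0 < s)%N -> (0 < d)%N -> (s + d)%N = n -> (k < survivors s d (tree_ beta w))%N ->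
  (d.+1 <= Delta (t := tree_ beta w) pi k)%N.
Proof.
move=> wP s0 d0 sdn kK; have := Delta_ge_survivors pi s0 d0 kK.
rewrite card_vertex size_vertices_tree //.
by rewrite (minn_idPl _) //; nia.
Qed.

End Cannings_tree.

Local Open Scope classical_set_scope.

(** * Estimates on the parameters for large n *)

Lemma powR_ge_near (R : realType) (b M : R) : 0 < b -> 0 <= M ->
  exists K : R, forall x, K <= x -> M <= x `^ b.
Proof.
move=> b0 M0; exists (M `^ b^-1) => x Mx.
rewrite -[M]powRr1 // -(mulVf (lt0r_neq0 b0)) powRrM.
apply: ge0_ler_powR => //; rewrite ?nnegrE ?powR_ge0 //; first exact: ltW.
exact: le_trans (powR_ge0 _ _) Mx.
Qed.

Section parameters.
Context {R : realType} (beta : R) (n : nat).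
Local Notation L := (ln (n%:R : R)).
Local Notation B := (L `^ beta).
Hypothesis L1 : 1 <= L.
Hypothesis B2 : 2 <= B.
Hypothesis BL : 4 * B <= L.

Let n0 : 0 < n%:R :> R.
Proof.
rewrite lt_neqAle ler0n andbT; apply/eqP => E.
by move: L1; rewrite -E ln0 // leNgt ltr01.
Qed.

Let nE : n%:R = expR L. Proof. by rewrite lnK ?posrE. Qed.

Let B0 : 0 < B. Proof. by apply: lt_le_trans B2. Qed.

Let nB1 : 1 <= n%:R / B.
Proof.
rewrite ler_pdivlMr // mul1r; apply: le_trans (_ : L <= _); first by move: BL B0; lra.
by rewrite nE; apply: le_trans (expR_ge1Dx _); rewrite lnK ?posrE // lerDr.
Qed.

Let r_ltr : (r_ beta n)%:R <= n%:R / B.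
Proof. by rewrite truncn_le divr_ge0 ?powR_ge0. Qed.

Let r_half : (r_ beta n)%:R * 2 <= n%:R :> R.
Proof.
move: r_ltr; rewrite ler_pdivlMr //; apply: le_trans.
by apply: ler_wpM2l.
Qed.

Lemma r_gt0_large : (0 < r_ beta n)%N.
Proof. by rewrite truncn_gt0. Qed.

Lemma r_le_large : (r_ beta n <= n)%N.
Proof. by rewrite -(ler_nat R); move: r_half (ler0n R (r_ beta n)); lra. Qed.

Let p_E : p_ beta n = B ^+ 2 / n%:R.
Proof. by rewrite /p_ (mulrC 2) powRrM powR_mulrn ?powR_ge0. Qed.

(** [n = exp L >= 1 + L ^ 2 / 2], which exceeds [B ^ 2] since [4 * B <= L]. *)
Lemma p_01_large : 0 <= p_ beta n <= 1.
Proof.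
rewrite p_E divr_ge0 ?sqr_ge0 //= ler_pdivrMr // mul1r [leRHS]nE.
apply: le_trans (expR_ge1Dxn 1 (le_trans ler01 L1)).
rewrite (_ : 2`!%:R = 2) //; move: BL B0; set x := B; set y := L => xy x0.
have : 0 <= (y - 4 * x) * (y + 4 * x) by rewrite mulr_ge0 //; lra.
have : 0 <= x ^+ 2 by exact: sqr_ge0.
by nra.
Qed.

(** From [r <= n / B <= n / 2], an event raises the weight by a proportion of at most [2 / B]; times
    [p = B ^ 2 / n] this gives [2 * B / n] per generation. Over at most [n] generations the factor
    is at most [exp (2 * B)], against [n = exp L] with [4 * B <= L]. *)
Lemma loss_factor_large (d : nat) : (d <= n)%N ->
  loss_factor beta n ^+ d / n%:R <= expR (- (L / 2)).
Proof.
move=> dn.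
have lf : loss_factor beta n <= expR (2 * B / n%:R).
  apply: le_trans (expR_ge1Dx _); rewrite /loss_factor lerD2l p_E.
  have rn := r_le_large.
  have d0 : 0 < (n.+2 - r_ beta n)%:R :> R by rewrite ltr0n; lia.
  apply: (@le_trans _ _ (B ^+ 2 / n%:R * (2 / B))).
    apply: ler_wpM2l; first by rewrite divr_ge0 ?sqr_ge0.
    rewrite lerBlDr ler_pdivrMr // natrB; last lia.
    rewrite -[n.+2]addn2 -addn1 !natrD -ler_pdivrMl; last by rewrite addr_gt0 ?divr_gt0.
    move: r_ltr r_half B2; rewrite ler_pdivlMr // => h1 h2 h3.
    rewrite mulrC ler_pdivrMr ?addr_gt0 ?divr_gt0 //.
    rewrite -(ler_pM2r B0) -mulrA [X in _ <= _ * X]mulrDl divfK ?gt_eqF //.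
    by move: n0; set r := (r_ beta n)%:R in h1 h2 *; nra.
  rewrite le_eqVlt; apply/orP; left; apply/eqP; field.
  by rewrite !gt_eqF.
have lf0 : 0 <= loss_factor beta n.
  by apply: loss_factor_ge0; [exact: r_gt0_large|exact: r_le_large|exact: p_01_large].
apply: (@le_trans _ _ (expR (2 * B) * expR (- L))).
  rewrite expRN -nE; apply: ler_wpM2r; first by rewrite invr_ge0 ltW.
  apply: le_trans (_ : expR (2 * B / n%:R) ^+ d <= _); first by rewrite lerXn2r ?nnegrE ?expR_ge0.
  rewrite -expRM_natl ler_expR mulrCA -[leRHS]mulr1; apply: ler_wpM2l.
    by rewrite mulr_ge0 // ltW.
  by rewrite ler_pdivrMr // mul1r ler_nat.
rewrite -expRD ler_expR; move: BL; lra.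
Qed.

End parameters.

(** [0 < beta] gives [L ^ beta >= 2]; [beta < 1] gives [L ^ (1 - beta) >= 4], that is
    [4 * L ^ beta <= L]; and [L >= 2 / eta] gives [exp (L / 2) >= 1 / eta]. *)
Lemma parameters_near (R : realType) (beta eta : R) : 0 < beta < 1 -> 0 < eta ->
  \forall n \near \oo,
    [/\ (0 < r_ beta n)%N, (r_ beta n <= n)%N, 0 <= p_ beta n <= 1 &
      forall d, (d <= n)%N -> loss_factor beta n ^+ d / n%:R <= eta].
Proof.
move=> /andP[b0 b1] e0.
have [K1 H1] := powR_ge_near b0 (ler0n R 2).
have [K2 H2] := powR_ge_near (b := 1 - beta) (M := 4) ltac:(lra) ltac:(lra).
near=> n.
have LM : Num.max (Num.max K1 K2) (Num.max 1 (2 / eta)) <= ln (n%:R : R).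
  have H : expR (Num.max (Num.max K1 K2) (Num.max 1 (2 / eta))) <= n%:R :> R.
    by near: n; exact: nbhs_infty_ger.
  by rewrite -[leLHS]expRK ler_ln // posrE ?expR_gt0 // (lt_le_trans (expR_gt0 _) H).
move: LM; rewrite !ge_max => /andP[/andP[k1 k2] /andP[L1 Le]].
have B2 := H1 _ k1; have B4 := H2 _ k2.
set L := ln _ in k1 k2 L1 Le B2 B4.
have BL : 4 * L `^ beta <= L.
  have L0 : 0 < L by exact: lt_le_trans ltr01 L1.
  have E : L `^ (1 - beta) * L `^ beta = L.
    by rewrite -powRD ?subrK ?powRr1 ?ltW // (gt_eqF L0) implybT.
  by rewrite -[leRHS]E; apply: ler_wpM2r; rewrite ?powR_ge0.
split; [exact: r_gt0_large|exact: r_le_large|exact: p_01_large|].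
move=> d dn; apply: le_trans (loss_factor_large L1 B2 BL dn) _.
rewrite expRN -[eta]invrK lef_pV2 ?posrE ?expR_gt0 ?invr_gt0 //.
apply: le_trans (expR_ge1Dx _); rewrite -/L.
by move: Le; rewrite mulrC; lra.
Unshelve. all: by end_near. Qed.

(** Serves both conclusions: [X] will be the proportion of orderings with large [Delta], then a
    functional of the height function. *)
Lemma survivors_near (R : realType) (beta : R) (k : nat) (a : R)
    (X : forall n, draws n -> R) : 0 < beta < 1 -> 0 <= a ->
  (forall n w, 0 <= X n w) ->
  (forall n (w : draws n), (2 <= n)%N -> (0 < r_ beta n <= n)%N ->
     proper_draws beta w ->
     (k <= survivors n./2 (n - n./2) (tree_ beta w))%N -> a <= X n w) ->
  \forall n \near \oo, a / 2 <= E_ beta (X n).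
Proof.
move=> b01 a0 X0 Xa.
(* With this bound on the mean weight the failure term [k * eta] is at most 1/2; the successor
   covers [k = 0]. *)
have e0 : 0 < (2 * k.+1%:R)^-1 :> R by rewrite invr_gt0 mulr_gt0.
have H := parameters_near b01 e0; near=> n.
have [r0 rn p01 lf] : [/\ (0 < r_ beta n)%N, (r_ beta n <= n)%N, 0 <= p_ beta n <= 1 &
      forall d, (d <= n)%N -> loss_factor beta n ^+ d / n%:R <= (2 * k.+1%:R)^-1]
  by near: n.
have n2 : (2 <= n)%N by near: n; exists 2%N.
have sdn : (n./2 + (n - n./2))%N = n by lia.
apply: le_trans (E_ge_survivors (k := k) r0 rn p01 a0 _ sdn (X0 n) _); last first.
- by move=> w wP; apply: Xa => //; rewrite r0.
- by lia.
apply: ler_wpM2l => //.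
have := lf (n - n./2)%N (leq_subr _ _).
move=> /(ler_wpM2l (ler0n R k.+1)) H'.
have : k%:R * (loss_factor beta n ^+ (n - n./2) / n%:R) <= 2^-1.
  apply: le_trans (_ : k.+1%:R * (loss_factor beta n ^+ (n - n./2) / n%:R) <= _).
    by apply: ler_wpM2r; rewrite ?ler_nat // divr_ge0 ?exprn_ge0 // loss_factor_ge0.
  by apply: le_trans H' _; rewrite invfM mulrCA mulfV ?mulr1.
by lra.
Unshelve. all: by end_near. Qed.

(** * Failure of tightness *)

Lemma limn_esup_ge (R : realType) (u : (\bar R)^nat) (c : \bar R) :
  (\forall n \near \oo, c <= u n)%E -> (c <= limn_esup u)%E.
Proof.
move=> cu; apply: le_ereal_inf_tmp => _ [V Voo <-].
have [n [cn Vn]] := filter_ex (filterI cu Voo).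
by apply: le_trans cn _; apply: ereal_sup_ubound; exists n.
Qed.

(** Take [delta = 1 / 4]. When more than [k] families survive from height [n./2], every ordering has
    [Delta] above [n / 2], so the proportion is 1; hence the upper limit is at least 1/2 for every
    [k]. *)
Lemma not_tree_tight (R : realType) (beta : R) : 0 < beta < 1 -> ~ tree_tight beta.
Proof.
move=> b01 /(_ (1 / 4) ltac:(lra)) tight.
have H k : ((1 / 2)%:E <= limn_esup (fun n => (Pr_Delta_gt beta n k (1 / 4 * n%:R))%:E))%E.
  apply: limn_esup_ge; under eq_near do rewrite lee_fin.
  apply: (survivors_near (k := k.+1) (X := fun n (w : draws n) =>
    #|[pred pi : {perm 'I_#|vertex (tree_ beta w)|} |
         (1 / 4 * n%:R : R) < (Delta pi k)%:R]|%:R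
    / #|{: {perm 'I_#|vertex (tree_ beta w)|}}|%:R) b01 ler01).
    by move=> n w; rewrite divr_ge0.
  move=> n w n2 /andP[r0 rn] wP K.
  rewrite (_ : #|_| = #|{: {perm 'I_#|vertex (tree_ beta w)|}}|).
    by rewrite divff // pnatr_eq0 -lt0n; apply/card_gt0P; exists 1%g.
  apply: eq_card => pi; rewrite !inE.
  have sdn : (n./2 + (n - n./2))%N = n by lia.
  have := Delta_tree_ge (ltnW n2) r0 rn pi wP (_ : 0 < n./2)%N (_ : 0 < n - n./2)%N sdn K.
  move=> /(_ ltac:(lia) ltac:(lia)); rewrite -(ler_nat R).
  apply: lt_le_trans.
  have : (n%:R : R) <= (2 * (n - n./2))%:R by rewrite ler_nat; lia.
  rewrite natrM -(natr1 (n - n./2)%N); move: (n - n./2)%N => d.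
  have : 2 <= n%:R :> R by rewrite ler_nat.
  by move: (n%:R : R) (d%:R : R) => x y; lra.
have : ((1 / 2 : R)%:E <= 0)%E by exact: cvge_ge (nearW _ H) tight.
by rewrite lee_fin; lra.
Qed.

(** * Upward moves of paths *)

Section upcrossings.
Context {R : realType}.
Implicit Types (f g x : R -> R) (e T : R) (m : nat).

(** Unlike upcrossings of an interval, the moves have no prescribed levels, so a uniform
    perturbation of the path only changes [e]. *)
Definition has_upmoves f e m : Prop := exists s t : nat -> R,
  [/\ forall i, (i < m)%N -> 0 <= s i <= t i,
      forall i j, (i < j < m)%N -> t i <= s j &
      forall i, (i < m)%N -> e <= f (t i) - f (s i)].

(** The cap at 1 makes the functional bounded over all paths; [e = 0] is always admissible. *)
Definition upmove_size m f : R := sup [set e | 0 <= e <= 1 /\ has_upmoves f e m].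

Lemma has_upmoves0 f m : has_upmoves f 0 m.
Proof. by exists (fun=> 0), (fun=> 0); split=> // *; rewrite ?lexx ?subrr. Qed.

Lemma has_upmoves_le f e m m' : (m' <= m)%N -> has_upmoves f e m -> has_upmoves f e m'.
Proof.
move=> mm [s [t [H1 H2 H3]]]; exists s, t; split.
- by move=> i im; apply: H1; apply: leq_trans mm.
- by move=> i j /andP[ij jm]; apply: H2; rewrite ij (leq_trans jm).
- by move=> i im; apply: H3; apply: leq_trans mm.
Qed.

Lemma has_upmoves_le_size f e e' m : e' <= e -> has_upmoves f e m -> has_upmoves f e' m.
Proof.
move=> ee [s [t [H1 H2 H3]]]; exists s, t; split=> // i im.
exact: le_trans (H3 i im).
Qed.

Lemma upmove_size_has_sup m f : has_sup [set e | 0 <= e <= 1 /\ has_upmoves f e m].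
Proof.
split; first by exists 0; split; [rewrite lexx ler01|exact: has_upmoves0].
by exists 1 => e [/andP[]].
Qed.

Lemma upmove_size_ge m f e : 0 <= e <= 1 -> has_upmoves f e m -> e <= upmove_size m f.
Proof.
by move=> e01 H; apply: ub_le_sup; [exact: (upmove_size_has_sup m f).2|].
Qed.

Lemma upmove_size_01 m f : 0 <= upmove_size m f <= 1.
Proof.
rewrite upmove_size_ge ?lexx ?ler01 //=; last exact: has_upmoves0.
by apply: ge_sup; [exact: (upmove_size_has_sup m f).1|move=> e [/andP[]]].
Qed.

Lemma upmove_size_le m f g d : 0 <= d ->
  (forall e, has_upmoves f e m -> has_upmoves g (e - d) m) ->
  upmove_size m f <= upmove_size m g + d.
Proof.
move=> d0 H; apply: ge_sup; first exact: (upmove_size_has_sup m f).1.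
move=> e [/andP[e0 e1] fe]; have /andP[g0 _] := upmove_size_01 m g.
rewrite -lerBlDr; have [ed|de] := leP (e - d) 0; first exact: le_trans g0.
by apply: upmove_size_ge (H _ fe); rewrite ltW //=; lra.
Qed.

(** An increasing bijection carries moves of either path to moves of the other, and each increment
    changes by at most [2 * d]. *)
Lemma upmove_size_time_change m f g la d : time_change la ->
  (forall t, 0 <= t -> `|g (la t) - f t| <= d) ->
  `|upmove_size m f - upmove_size m g| <= 2 * d.
Proof.
move=> Tl H; have [l0 li ls] := Tl.
have lmono s t : 0 <= s -> s <= t -> la s <= la t.
  by move=> s0; rewrite le_eqVlt => /predU1P[->//|st]; exact/ltW/li.
have linv s t : 0 <= t -> la s <= la t -> s <= t.
  by move=> t0; apply: contraLR; rewrite -!ltNge; exact: li.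
have d0 : 0 <= d by apply: le_trans (H 0 (lexx _)).
suff [A B] : upmove_size m f <= upmove_size m g + 2 * d /\
             upmove_size m g <= upmove_size m f + 2 * d.
  by rewrite ler_norml; lra.
split; apply: upmove_size_le; rewrite ?mulr_ge0 // => e [s [t [H1 H2 H3]]]; last first.
- have inv u : exists v, 0 <= u -> 0 <= v /\ la v = u.
    have [u0|u0] := leP 0 u; last by exists 0.
    by have [v v0 vu] := ls u u0; exists v.
  have [s' s'E] := choice (fun i => inv (s i)); have [t' t'E] := choice (fun i => inv (t i)).
  have s0 i : (i < m)%N -> 0 <= s i by move/H1/andP=> [].
  have t0 i : (i < m)%N -> 0 <= t i by move/H1/andP=> [/le_trans]; apply.
  exists s', t'; split.
  + move=> i im; have [s'0 sE] := s'E i (s0 i im); have [t'0 tE] := t'E i (t0 i im).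
    by rewrite s'0 linv // sE tE; have /andP[] := H1 _ im.
  + move=> i j ijm; have /andP[ij jm] := ijm; have im := ltn_trans ij jm.
    have [s'0 sE] := s'E j (s0 j jm); have [t'0 tE] := t'E i (t0 i im).
    by rewrite linv // sE tE H2.
  + move=> i im; have [s'0 sE] := s'E i (s0 i im); have [t'0 tE] := t'E i (t0 i im).
    have := H _ s'0; have := H _ t'0; have := H3 i im.
    by rewrite sE tE !ler_norml; lra.
- exists (la \o s), (la \o t); split.
  + move=> i /H1/andP[s0 st] /=; rewrite lmono //.
    by rewrite time_change_ge0.
  + move=> i j ijm; have /andP[ij jm] := ijm; have im := ltn_trans ij jm.
    apply: lmono; last exact: H2.
    by have /andP[/le_trans] := H1 _ im; apply.
  + move=> i im /=; have /andP[s0 st] := H1 _ im; have t0 := le_trans s0 st.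
    have := H _ s0; have := H _ t0; have := H3 i im.
    by rewrite !ler_norml; lra.
Qed.

(* Clipping below a decreasing barrier makes the functional insensitive to
   large times, on which the J1 topology gives no uniform control. *)
Definition clip_path x (t : R) : R := Num.max 0 (Num.min (3 - t) (x t)).

Lemma clip_lipschitz (a b a' b' d : R) : `|a - a'| <= d -> `|b - b'| <= d ->
  `|Num.max 0 (Num.min a b) - Num.max 0 (Num.min a' b')| <= d.
Proof.
rewrite !ler_norml /Num.max /Num.min => /andP[a1 a2] /andP[b1 b2].
by case: (ltP a b) => ?; case: (ltP a' b') => ?; do 2!case: ltP => ?; apply/andP; split; lra.
Qed.

Lemma clip_path_out x t : 3 <= t -> clip_path x t = 0.
Proof.
move=> t3; apply/max_idPl; rewrite ge_min; apply/orP; left; lra.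
Qed.

(** Beyond time 4 the ball does not control the values, but [e <= 1] keeps [la t] above 3, where the
    clipped path vanishes. *)
Lemma upmove_size_sk_ball m (x y : skorokhod R) e : e <= 1 -> sk_ball x 4 e y ->
  `|upmove_size m (clip_path x) - upmove_size m (clip_path y)| <= 2 * e.
Proof.
move=> e1 [la [e' [Tl ee l1 l2]]].
apply: le_trans (_ : 2 * e' <= _); last by rewrite ler_pM2l // ltW.
apply: (upmove_size_time_change m Tl) => t t0.
have lt := l1 t t0; have [t4|t4] := leP t 4.
  apply: clip_lipschitz; last by apply: l2; rewrite t0.
    by rewrite (_ : 3 - la t - (3 - t) = - (la t - t)) ?normrN //; ring.
rewrite !clip_path_out ?subrr ?normr0; [exact: le_trans lt|lra|].
by move: lt; rewrite ler_norml; lra.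
Qed.

Lemma upmove_size_sk_continuous m :
  continuous (fun y : skorokhod R => upmove_size m (clip_path y)).
Proof.
move=> x; have FF : Filter (nbhs x) by exact: nbhs_filter.
apply/(@cvgrPdist_lt _ _ _ (nbhs x) FF) => e e0.
exists 4, (Num.min 1 (e / 4)); split=> //; first by rewrite lt_min ltr01 /=; lra.
move=> y /upmove_size_sk_ball H /=.
apply: le_lt_trans (H _ _) _; first by rewrite ge_min lexx.
have : Num.min 1 (e / 4) <= e / 4 by rewrite ge_min lexx orbT.
lra.
Qed.

Lemma upmove_size_continuous m :
  continuous (fun p : skorokhod R * skorokhod R => upmove_size m (clip_path p.2)).
Proof.
move=> p; apply: (cvg_comp snd (fun y : skorokhod R => upmove_size m (clip_path y))).
  exact: cvg_snd.
exact: upmove_size_sk_continuous.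
Qed.

(** * Finiteness of the upward moves of a cadlag path *)

Definition small_osc f e (a b : R) : Prop :=
  forall s t, a <= s < b -> a <= t < b -> `|f s - f t| < e.

Definition has_upmoves_before f e m T : Prop := exists s t : nat -> R,
  [/\ forall i, (i < m)%N -> 0 <= s i <= t i,
      forall i j, (i < j < m)%N -> t i <= s j,
      forall i, (i < m)%N -> e <= f (t i) - f (s i) &
      forall i, (i < m)%N -> t i < T].

(** If one of the first [m] moves ended at or after [T], the last move would lie inside [[T, T')],
    where the path oscillates by less than [e]. *)
Lemma upmoves_extend f e m T T' : small_osc f e T T' ->
  ~ has_upmoves_before f e m T -> ~ has_upmoves_before f e m.+1 T'.
Proof.
move=> fT H [s [t [H1 H2 H3 H4]]]; apply: H.
exists s, t; split.
- by move=> i im; apply: H1; apply: ltnW.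
- by move=> i j /andP[ij jm]; apply: H2; rewrite ij ltnW.
- by move=> i im; apply: H3; apply: ltnW.
- move=> i im; rewrite ltNge; apply/negP => Ti.
  have tis : t i <= s m by apply: H2; rewrite im ltnSn.
  have /andP[_ st] := H1 m (ltnSn _); have tT := H4 m (ltnSn _).
  have := fT (t m) (s m); rewrite tT (le_lt_trans st) // !(le_trans Ti) //; last first.
    exact: le_trans st.
  move=> /(_ isT isT); have := H3 m (ltnSn _).
  by rewrite ltr_norml; lra.
Qed.

Lemma small_osc_right x e t : cadlag x -> 0 <= t -> 0 < e ->
  exists2 d, 0 < d & small_osc (clip_path x) e t (t + d).
Proof.
move=> [xr _] t0 e0; have e2 : 0 < e / 3 by lra.
have /cvgrPdist_lt/(_ _ e2) [/= d d0 H] := xr t t0.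
(* Values within [e / 3] of a common one differ by less than [e]; the barrier [3 - t] also moves by
   at most [e / 3]. *)
have close s : t <= s < t + Num.min d (e / 3) ->
    `|clip_path x t - clip_path x s| <= e / 3.
  rewrite -ltrBlDl lt_min => /andP[ts /andP[sd se]].
  move: ts; rewrite le_eqVlt => /predU1P[<-|ts].
    by rewrite subrr normr0 ltW.
  apply: clip_lipschitz.
    by rewrite ler_norml; lra.
  by apply/ltW/H => //=; rewrite distrC gtr0_norm // subr_gt0.
exists (Num.min d (e / 3)); first by rewrite lt_min d0.
move=> s s' /close; move=> h1 /close h2.
by move: h1 h2; rewrite ltr_norml !ler_norml; lra.
Qed.

Lemma small_osc_left x e t : cadlag x -> 0 < t -> 0 < e ->
  exists2 d, 0 < d & small_osc (clip_path x) e (t - d) t.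
Proof.
move=> [_ xl] t0 e0; have e2 : 0 < e / 3 by lra.
have /cvg_ex[l /cvgrPdist_lt/(_ _ e2) [/= d d0 H]] := xl t t0.
have close s : t - Num.min (d / 2) (e / 3) <= s < t ->
    `|Num.max 0 (Num.min (3 - t) l) - clip_path x s| <= e / 3.
  rewrite lerBlDl -lerBlDr le_min => /andP[/andP[sd se] st].
  apply: clip_lipschitz; first by rewrite ler_norml; lra.
  by apply/ltW; apply: H => //=; rewrite gtr0_norm; lra.
exists (Num.min (d / 2) (e / 3)); first by rewrite lt_min; lra.
move=> s s' /close; move=> h1 /close h2.
by move: h1 h2; rewrite ltr_norml !ler_norml; lra.
Qed.

(** Compactness of [[0, 4]] in the form of a supremum: left limits bound the moves before [sup S],
    and right continuity pushes the bound further unless [sup S = 4]. Beyond 4 the clipped path is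
    0. *)
Lemma cadlag_upmoves_finite x e : cadlag x -> 0 < e ->
  exists m, ~ has_upmoves (clip_path x) e m.
Proof.
move=> cx e0; pose bounded T := exists m, ~ has_upmoves_before (clip_path x) e m T.
pose S := [set T | 0 <= T <= 4 /\ bounded T].
have b0 : bounded 0.
  exists 1%N => -[s [t [H1 _ _ H4]]].
  have /andP[s0 st] := H1 0%N (ltnSn _); have := H4 0%N (ltnSn _).
  by rewrite ltNge (le_trans s0).
have extend T T' : small_osc (clip_path x) e T T' -> bounded T -> bounded T'.
  by move=> h [m H]; exists m.+1; exact: upmoves_extend H.
have S0 : has_sup S.
  split; last by exists 4 => T [/andP[]].
  by exists 0; split; rewrite ?lexx /=.
have S0S : S 0 by split=> //; rewrite lexx ler0n.
have S00 : 0 <= sup S by apply: ub_le_sup; [exact: S0.2|exact: S0S].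
have S4 : sup S <= 4 by apply: ge_sup; [exact: S0.1|] => T [/andP[]].
have bS : bounded (sup S).
  move: (S00); rewrite le_eqVlt => /predU1P[<-//|S01].
  have [d d0 H] := small_osc_left cx S01 e0.
  have [T TS Td] := sup_adherent d0 S0.
  apply: extend (TS.2) => s t /andP[Ts sS] /andP[Tt tS].
  by apply: H; rewrite ?sS ?tS andbT; lra.
have b4 : bounded 4.
  move: (S4); rewrite le_eqVlt => /predU1P[<-//|S4'].
  have [d d0 H] := small_osc_right cx S00 e0.
  have : Num.min (sup S + d) 4 <= sup S.
    apply: ub_le_sup; [exact: S0.2|split].
      by rewrite le_min ge_min lexx orbT andbT; lra.
    apply: extend bS => s t; rewrite !lt_min => /andP[h1 /andP[h2 _]] /andP[h3 /andP[h4 _]].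
    by apply: H; apply/andP.
  by rewrite ge_min; lra.
have [m mP] := b4; exists m.+1 => -[s [t [H1 H2 H3]]].
(* [t m + 1] lies after the end of all [m.+1] moves. *)
have := @upmoves_extend (clip_path x) e m 4 (t m + 1) _ mP; apply.
  move=> u v /andP[u4 _] /andP[v4 _].
  by rewrite !clip_path_out ?subrr ?normr0 //; lra.
exists s, t; split=> // i; rewrite ltnS leq_eqVlt => /predU1P[->|im].
  by rewrite ltrDl.
have /andP[_ st] := H1 m (ltnSn _).
have : t i <= s m by apply: H2; rewrite im ltnSn.
by lra.
Qed.

Lemma cadlag_upmove_size_cvg x : cadlag x ->
  upmove_size m (clip_path x) @[m --> \oo] --> 0.
Proof.
move=> cx; apply/cvgrPdist_le => e e0.
have [N NP] := cadlag_upmoves_finite cx e0.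
exists N => // m /= Nm; have /andP[g0 g1] := upmove_size_01 m (clip_path x).
rewrite sub0r normrN ger0_norm //; apply: ge_sup; first exact: (upmove_size_has_sup _ _).1.
move=> e' [e'01 H]; rewrite leNgt; apply/negP => ee; apply: NP.
exact: has_upmoves_le_size (ltW ee) (has_upmoves_le Nm H).
Qed.

End upcrossings.

(* The expectation of a nonnegative function, measurable or not, is a supremum
   over its measurable minorants, to which dominated convergence applies. *)
Lemma expectation_not_bounded_below d (T : measurableType d) (R : realType)
    (P : probability T R) (f : nat -> T -> R) (c : R) :
  0 < c -> (forall m w, 0 <= f m w <= 1) -> (forall w, f m w @[m --> \oo] --> 0) ->
  ~ (forall m, c%:E <= 'E_P[f m])%E.
Proof.
move=> c0 f01 fc H; have c2 : c / 2 < c by lra.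
have minorant m : exists h : {nnsfun T >-> R},
    (forall w, h w <= f m w) /\ ((c / 2)%:E <= \int[P]_w (h w)%:E)%E.
  have := H m; rewrite expectation.unlock ge0_integralTE; last first.
    by move=> w; rewrite lee_fin; case/andP: (f01 m w).
  move=> cs; have c2e : ((c / 2)%:E < c%:E)%E by rewrite lte_fin.
  have /ereal_sup_gt[_ [h hf <-] ch] := lt_le_trans c2e cs.
  exists h; split; first by move=> w; have := hf w; rewrite lee_fin.
  by rewrite integralT_nnsfun ltW.
have [h hP] := choice minorant.
have h0 m w : 0 <= h m w by exact: fun_ge0.
have int1 : P.-integrable setT (EFin \o cst (1 : R)).
  exact: finite_measure_integrable_cst.
have [_ _ cvg0] : [/\ P.-integrable setT (cst 0%E),
    \int[P]_w `|(h m w)%:E - 0|%E @[m --> \oo] --> 0%E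
  & \int[P]_w (h m w)%:E @[m --> \oo] --> \int[P]_w (cst (0 : \bar R) w)]%E.
  apply: (dominated_convergence measurableT _ _ _ int1) => //.
  - by move=> m; apply/measurable_EFinP.
  - apply/aeW => w _; apply: cvg_EFin; first exact: nearW.
    apply: (@squeeze_cvgr _ _ _ _ (cst 0) (fun m => f m w)); [|exact: cvg_cst|exact: fc].
    by apply: nearW => m; rewrite h0 (hP m).1.
  - apply/aeW => w m _ /=; rewrite lee_fin ger0_norm //.
    by apply: le_trans ((hP m).1 w) _; case/andP: (f01 m w).
have : ((c / 2)%:E <= \int[P]_w (cst (0 : \bar R) w))%E.
  by apply: cvge_ge cvg0; apply: nearW => m; exact: (hP m).2.
by rewrite integral0 lee_fin; lra.
Qed.

(** * Upward moves of the height function *)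

Lemma size_pair_flatten (T : Type) (Z : seq (T * T)) :
  size (pair_flatten Z) = (size Z).*2.
Proof. by elim: Z => // z Z IH; rewrite -cat1s pair_flatten_cat size_cat IH. Qed.

Lemma nth_pair_flatten (T : Type) (x : T) (Z : seq (T * T)) i : (i < size Z)%N ->
  nth x (pair_flatten Z) i.*2 = (nth (x, x) Z i).1 /\
  nth x (pair_flatten Z) i.*2.+1 = (nth (x, x) Z i).2.
Proof. by elim: Z i => //= z Z IH [|i] //= /IH. Qed.

Lemma subseq_index_lt (T : eqType) (x : T) (s1 s2 : seq T) i j :
  subseq s1 s2 -> uniq s2 -> (i < j < size s1)%N ->
  (index (nth x s1 i) s2 < index (nth x s1 j) s2)%N.
Proof.
move=> s12 u2 /andP[ij j1].
have : pairwise (relpre (index^~ s2) ltn) s2.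
  rewrite -pairwise_map (_ : map _ _ = iota 0 (size s2)).
    by rewrite -sorted_pairwise ?iota_ltn_sorted //; exact: ltn_trans.
  case: s2 u2 {s12} => // y s2 u2; apply: (@eq_from_nth _ 0%N).
    by rewrite size_map size_iota.
  move=> k; rewrite size_map => ks; rewrite (nth_map y) // nth_iota // add0n.
  by rewrite index_uniq.
move=> /(subseq_pairwise s12)/(pairwiseP x); apply=> //.
exact: ltn_trans j1.
Qed.

Lemma H_index t v : v \in vertices t -> H_ t (index v (vertices t)) = size v.
Proof.
by move=> vt; rewrite /H_ (nth_map v) ?index_mem // nth_index.
Qed.

Section height_upmoves.
Context {R : realType} (beta : R) (n : nat) (w : draws n).
Hypothesis n2 : (2 <= n)%N.
Hypothesis r_gt0 : (0 < r_ beta n)%N.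
Hypothesis r_le : (r_ beta n <= n)%N.
Hypothesis wP : proper_draws beta w.

(** Clipping is harmless here: the [n * n + 1] vertices are visited at times at most 1, where the
    barrier is at least 2, and scaled heights are at most 1. *)
Lemma clip_scaled_height (v : seq nat) : v \in vertices (tree_ beta w) -> (size v <= n)%N ->
  clip_path (scaled_height beta w)
    ((index v (vertices (tree_ beta w)))%:R / n%:R ^+ 2) = (size v)%:R / n%:R.
Proof.
move=> vt vn; set i := index _ _.
have n0 : 0 < n%:R :> R by rewrite ltr0n; lia.
have i0 : 0 <= i%:R / n%:R ^+ 2 :> R by rewrite divr_ge0 ?sqr_ge0.
have -> : (scaled_height beta w : R -> R) = on_halfline
   (step (fun i => (H_ (tree_ beta w) i)%:R / n%:R) (1%:R * n%:R ^+ 2)) by [].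
rewrite /clip_path /on_halfline ltNge i0 /= /step mul1r.
rewrite [_ ^+ 2 * _]mulrC divfK ?expf_neq0 ?gt_eqF // natrK H_index //.
have h1 : (size v)%:R / n%:R <= 1 :> R by rewrite ler_pdivrMr // mul1r ler_nat.
have h0 : 0 <= (size v)%:R / n%:R :> R by rewrite divr_ge0 // ltW.
have i1 : i%:R / n%:R ^+ 2 <= 1 :> R.
  rewrite ler_pdivrMr ?exprn_gt0 // mul1r -natrX ler_nat -ltnS.
  have := vt; rewrite -index_mem (size_vertices_tree _ r_gt0 r_le wP); lia.
rewrite (min_idPr _); last lra.
by apply/max_idPr.
Qed.

(** Each surviving vertex comes before its chosen descendant, which comes before the next surviving
    vertex. In between, the height rises by [n - n./2], at least half of [n]. *)
Lemma scaled_height_upmoves m : (m <= survivors n./2 (n - n./2) (tree_ beta w))%N ->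
  has_upmoves (clip_path (scaled_height beta w)) (1 / 4) m.
Proof.
move=> mK; have d0 : (0 < n - n./2)%N by lia.
have [Z [sZ /allP aZ zZ]] := survivors_subseq n./2 (tree_ beta w) d0.
set vs := vertices _ in zZ; have uv : uniq vs by exact: vertices_uniq.
pose z i := nth ([::], [::]) Z i.
have zin i : (i < m)%N -> z i \in Z by move=> im; apply: mem_nth; rewrite sZ; lia.
have lt a b : (a < b < (size Z).*2)%N ->
    (index (nth [::] (pair_flatten Z) a) vs < index (nth [::] (pair_flatten Z) b) vs)%N.
  by rewrite -size_pair_flatten; exact: subseq_index_lt.
have mem k : (k < (size Z).*2)%N -> nth [::] (pair_flatten Z) k \in vs.
  by move=> kZ; apply: (mem_subseq zZ); apply: mem_nth; rewrite size_pair_flatten.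
have n0 : 0 < n%:R :> R by rewrite ltr0n; lia.
have nn0 : 0 < n%:R ^+ 2 :> R by rewrite exprn_gt0.
have ordered a b : (a < b < (size Z).*2)%N ->
    (index (nth [::] (pair_flatten Z) a) vs)%:R / n%:R ^+ 2 <=
    (index (nth [::] (pair_flatten Z) b) vs)%:R / n%:R ^+ 2 :> R.
  by move=> /lt ab; rewrite ler_pM2r ?invr_gt0 // ler_nat ltnW.
exists (fun i => (index (nth [::] (pair_flatten Z) i.*2) vs)%:R / n%:R ^+ 2),
       (fun i => (index (nth [::] (pair_flatten Z) i.*2.+1) vs)%:R / n%:R ^+ 2); split.
- move=> i im; apply/andP; split; first by rewrite divr_ge0 // ltW.
  by apply: ordered; lia.
- by move=> i j /andP[ij jm]; apply: ordered; lia.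
- move=> i im; have iZ : (i < size Z)%N by lia.
  have [E1 E2] := nth_pair_flatten [::] iZ.
  have /and3P[/eqP s1 /eqP s2 _] := aZ _ (zin i im).
  have m1 := mem i.*2 ltac:(lia); have m2 := mem i.*2.+1 ltac:(lia).
  rewrite !clip_scaled_height // ?E1 ?E2 ?s1 ?s2; [|lia|lia].
  rewrite -mulrBl ler_pdivlMr // natrD addrC addKr.
  have : n%:R <= 2 * (n - n./2)%:R :> R by rewrite -natrM ler_nat; lia.
  lra.
Qed.

End height_upmoves.

(** * Failure of tightness and of convergence in law *)

Theorem theoremA1 (R : realType) (beta : R) (hbeta : 0 < beta < 1) :
  ~ tree_tight beta /\
  (let ell : R -> R := \1_(`[0, 1[%classic) in
   let sigma : R -> R := \1_(`[0, 1[%classic) in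
   let l := ell_sigma 1 ell sigma in
   forall (d : measure_display) (Omega : measurableType d)
     (P : probability Omega R) (W : Omega -> Cbridge R),
     conditioned_BM1 (normalized l) P W ->
     ~ cvg_in_law beta
         (fun (n : nat) (w : draws n) => (scaled_contour beta w, scaled_height beta w))
         P
         (fun w => (limit_path l sigma (W w), limit_path l sigma (W w)))).
Proof.
split; first exact: not_tree_tight.
move=> ell sigma l d Omega P W _ conv.
pose G m (p : skorokhod R * skorokhod R) := upmove_size m (clip_path p.2).
have G01 m p : 0 <= G m p <= 1 by exact: upmove_size_01.
apply: (@expectation_not_bounded_below _ _ _ P
  (fun m w => G m (limit_path l sigma (W w), limit_path l sigma (W w))) (1 / 8)).
- by lra.
- by move=> m w; exact: G01.
- by move=> w; apply: cadlag_upmove_size_cvg; exact: skfun_cadlag.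
move=> m; have bG : exists M, forall p, `|G m p| <= M.
  by exists 1 => p; have /andP[g0 g1] := G01 m p; rewrite ger0_norm.
apply: cvge_ge (conv (G m) (@upmove_size_continuous R m) bG).
under eq_near do rewrite lee_fin.
(* Moves of size 1/4 occur with probability at least about 1/2, which [survivors_near] turns into
   the mean 1/8. *)
rewrite (_ : 1 / 8 = 1 / 4 / 2); last by field.
apply: (survivors_near (k := m) (a := 1 / 4)
  (X := fun n (w : draws n) => G m (scaled_contour beta w, scaled_height beta w)) hbeta).
- by lra.
- by move=> n w; case/andP: (G01 m (scaled_contour beta w, scaled_height beta w)).
- move=> n w n2 /andP[r0 rn] wP K.
  apply: upmove_size_ge; first lra.
  exact: scaled_height_upmoves.
Qed.
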